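(* Let $k\in\mathbb R\setminus\{0,1\}$, let $\phi_k(x)=\frac{x^k-kx+k-1}{k(k-1)}$ for $x\ge0$ and $\phi_k(x)=+\infty$ for $x<0$ (with $\phi_k(0)=+\infty$ if $k<0$), let $\tau>0$, and let $\mathcal R(X)$ be defined with divergence function $\phi=\phi_k$. (1) If $k>1$, there is a constant $C>0$ depending only on $k$ and $\tau$ such that for every $B>0$, every probability measure $P$ on a measurable space $(\Omega,\mathcal F)$, every measurable $X:\Omega\to[-B,B]$, every $\delta\in(0,1)$ and every $\epsilon\in(0,B]$, we have $|\mathcal R(X)-\mathcal R_n(X)|\le\epsilon$ with probability at least $1-\delta$ whenever $$n\ge C\,\Lambda^{C}\Big(\frac B\epsilon\Big)^{\max\{2,\,k/(k-1)\}},\qquad \Lambda=\log\Big(e+B+\frac1B+\frac1\epsilon+\frac1\delta\Big);$$ that is, the number of samples needed is bounded by $\tilde O\big((B/\epsilon)^{\max\{2,k/(k-1)\}}\big)$. (2) If $k<1$, obtaining an $\epsilon$-accurate estimate of $\mathcal R(X)$ can require an arbitrarily large number of samples: there exist a measurable space $(\Omega,\mathcal F)$, a bounded measurable $X:\Omega\to\mathbb R$ and $\epsilon_0>0$ such that for every $\epsilon\in(0,\epsilon_0)$, every positive integer $n$, and every $\mathcal F^{\otimes n}$-measurable estimator $\hat{\mathcal R}_n:\Omega^n\to\mathbb R$, there is a probability measure $P$ on $(\Omega,\mathcal F)$ with $P^{\otimes n}\big(|\hat{\mathcal R}_n-\mathcal R^P(X)|>\epsilon\big)\ge\frac14$.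
   Context: For a probability measure $P$ on $(\Omega,\mathcal F)$, divergence function $\phi$, radius $\tau$ and bounded measurable $X$, $$\mathcal R(X)=\mathcal R^P(X)=\sup\Big\{\int_\Omega X\zeta\,dP:\ \zeta\ge 0 \text{ measurable},\ \int_\Omega\zeta\,dP=1,\ \int_\Omega\phi(\zeta)\,dP\le\tau\Big\}.$$ $P_n$ is the empirical distribution of $n$ i.i.d. samples from $P$, and $\mathcal R_n(X)=\mathcal R^{P_n}(X)$ (same definition with $P$ replaced by $P_n$). An estimator is a function of $n$ i.i.d. samples from $P$. *)

(* Defs.v *)
From HB Require Import structures.
From mathcomp Require Import all_boot all_order all_algebra.
From mathcomp Require Import all_classical all_reals all_analysis.

Set Implicit Arguments.
Unset Strict Implicit.
Unset Printing Implicit Defensive.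

Import Order.TTheory GRing.Theory Num.Theory.
Import numFieldNormedType.Exports.

Local Open Scope classical_set_scope.
Local Open Scope ring_scope.

Section divergence_risk.
Context d (T : measurableType d) (R : realType).
Implicit Types (phi : R -> \bar R) (tau : R) (mu : {measure set T -> \bar R}).

Definition admissible_density phi tau mu (zeta : T -> R) : Prop :=
  [/\ measurable_fun [set: T] zeta,
      forall x, 0 <= zeta x,
      (\int[mu]_x (zeta x)%:E = 1)%E &
      (\int[mu]_x phi (zeta x) <= tau%:E)%E].

Definition risk phi tau mu (X : T -> R) : \bar R :=
  ereal_sup [set (\int[mu]_x (X x * zeta x)%:E)%E
            | zeta in admissible_density phi tau mu].

End divergence_risk.

(* The junk value [0 `^ k = 0] for [k < 0] is why [x = 0] is singled out. *)
Definition phi_power (R : realType) (k x : R) : \bar R :=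
  if (x < 0) || ((x == 0) && (k < 0)) then +oo%E
  else ((x `^ k - k * x + k - 1) / (k * (k - 1)))%:E.

Section empirical_measure.
Context d (T : measurableType d) (R : realType).

Definition empirical n (w : n.-tuple T) : {measure set T -> \bar R} :=
  mscale (n%:R^-1)%:nng (msum (fun i => \d_(nth point w i)) n).

Lemma empiricalE n (w : n.-tuple T) (A : set T) :
  empirical w A = ((n%:R^-1)%:E * \sum_(i < n) \d_(tnth w i) A)%E.
Proof.
rewrite /empirical/= /mscale/= /msum; congr (_ * _)%E.
by apply: eq_bigr => i _; rewrite (tnth_nth point).
Qed.

Lemma empirical_setT n (w : n.-tuple T) :
  (0 < n)%N -> empirical w [set: T] = 1%E.
Proof.
move=> n0; rewrite empiricalE.
under eq_bigr do rewrite diracT.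
rewrite sumEFin sumr_const card_ord -EFinM mulVf//.
by rewrite pnatr_eq0 -lt0n.
Qed.

End empirical_measure.
Arguments empirical {d T} R {n}.

Section product_power.
Context d (T : measurableType d) (R : realType).

Definition tuple_cons n (p : T * n.-tuple T) : n.+1.-tuple T :=
  [tuple of p.1 :: p.2].

Lemma measurable_tuple_cons n : measurable_fun setT (@tuple_cons n).
Proof. exact: measurable_cons. Qed.

HB.instance Definition _ n :=
  isMeasurableFun.Build _ _ _ _ (@tuple_cons n) (@measurable_tuple_cons n).

(* The [n]-fold product of [P] on [n.-tuple T], whose sigma-algebra is the one
   generated by the coordinates. *)
Fixpoint power_prob (P : probability T R) n : probability (n.-tuple T) R :=
  if n is m.+1 then distribution (P \x power_prob P m)%E (@tuple_cons m)
  else \d_[tuple].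

Lemma power_probE (P : probability T R) n (A : 'I_n -> set T) :
  (forall i, measurable (A i)) ->
  power_prob P n [set w | forall i, A i (tnth w i)] =
  (\prod_(i < n) P (A i))%E.
Proof.
elim: n A => [|n IHn] A mA.
  by rewrite big_ord0 /= diracE mem_set// => -[].
rewrite big_ord_recl -IHn//= /distribution /pushforward.
have mB : measurable [set w : n.-tuple T | forall i, A (lift ord0 i) (tnth w i)].
  rewrite (_ : [set _ | _] = \bigcap_i [set w | A (lift ord0 i) (tnth w i)]).
    apply: fin_bigcap_measurable => // i _; rewrite -[X in measurable X]setTI.
    exact: measurable_tnth.
  by apply/seteqP; split => [w Aw i _|w Aw i]; exact: Aw.
rewrite -product_measure1E//; congr (_ _).
apply/seteqP; split => [[x w] /= Aw|[x w] /= [Ax Aw] i].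
  by split => [|i]; [exact: (Aw ord0)|have := Aw (lift ord0 i); rewrite tnthS].
by case: (unliftP ord0 i) => [j|] ->//; rewrite tnthS.
Qed.

End product_power.

(* Main.v *)
Require Import Defs.
From HB Require Import structures.
From mathcomp Require Import all_boot all_order all_algebra.
From mathcomp Require Import all_classical all_reals all_analysis.
From mathcomp Require Import measurable_realfun.
From mathcomp Require Import ring lra.

Set Implicit Arguments.
Unset Strict Implicit.
Unset Printing Implicit Defensive.

Import Order.TTheory GRing.Theory Num.Theory.
Import numFieldNormedType.Exports.

Local Open Scope classical_set_scope.
Local Open Scope ring_scope.

(* Write [p] for the exponent conjugate to [k] and [c ^ k = 1 + k (k - 1) tau].
   For [k > 1] the constraints on a density [zeta] read [E zeta = 1] and
   [E zeta^k <= c^k], and the risk has the dual form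
     [inf_eta eta + c (E (X - eta)_+^p)^(1/p)],
   weak duality being Hoelder's inequality and strong duality following from an
   explicit optimal density proportional to [(X - eta)_+^(p - 1)].  The infimum
   is essentially over a bounded interval, on which the objective is Lipschitz in
   [eta], so it suffices to control finitely many empirical means of
   [[0, 1]]-valued variables.  A Chernoff bound that is sharp for small means gives
   a deviation of order [sqrt (m s) + s] with probability [1 - O(exp (- n s))], and
   after taking [p]-th roots this becomes [O(s^(1 / max(2, p)))].

   For [k < 1] the divergence grows only linearly at infinity, so a fixed amount
   of mass can be moved at bounded cost onto an event of arbitrarily small
   probability.  A Bernoulli law with tiny parameter and the Dirac mass at
   [false] then have risks a constant apart, although their [n]-samples agree
   with probability at least [1/2]. *)

(** * Bounds for the exponential and for roots *)

Section real_inequalities.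
Context {R : realType}.
Implicit Types x y z t l s m a p r : R.

Lemma powR_div x y r : 0 <= x -> 0 < y -> (x / y) `^ r = x `^ r / y `^ r.
Proof.
move=> x0 y0; rewrite powRM ?invr_ge0// ?(ltW y0)//.
by rewrite -(powR_inv1 (ltW y0)) -powRrM mulN1r powRN.
Qed.

(** After multiplication by 1 - x > 0 the left side is at most 1, and the right side exceeds 1 by
    x^2 (1 - 2x). Negative [x] is covered too, which the lower tail of the Chernoff bound uses. *)
Lemma expR_le_quad x : x <= 2^-1 -> expR x <= 1 + x + 2 * x ^+ 2.
Proof.
move=> x2.
have x1 : 0 < 1 - x by lra.
have h : 1 - x <= expR (- x) by exact: expR_ge1Dx.
have h2 : expR x * (1 - x) <= 1.
  by rewrite -[leRHS](expRxMexpNx_1 x) ler_pM2l ?expR_gt0.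
rewrite -(ler_pM2r x1); apply: (le_trans h2).
rewrite -subr_ge0 (_ : _ - 1 = x ^+ 2 * (1 - 2 * x)); last by ring.
by rewrite mulr_ge0 ?sqr_ge0//; lra.
Qed.

(* Average the tangent lines of [expR] at [l * z], evaluated at [0] and [l]. *)
Lemma expR_le_chord l z : 0 <= z <= 1 -> expR (l * z) <= 1 + z * (expR l - 1).
Proof.
move=> /andP[z0 z1]; set e := expR (l * z).
have h1 : e * (1 + l * (1 - z)) <= expR l.
  rewrite (_ : expR l = e * expR (l * (1 - z))).
    by rewrite ler_pM2l ?expR_gt0// expR_ge1Dx.
  by rewrite -expRD; congr expR; ring.
have h2 : e * (1 - l * z) <= 1.
  rewrite -[leRHS](expRxMexpNx_1 (l * z)) ler_pM2l ?expR_gt0//.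
  exact: expR_ge1Dx.
have h3 : z * (e * (1 + l * (1 - z))) <= z * expR l by rewrite ler_wpM2l.
have h4 : (1 - z) * (e * (1 - l * z)) <= (1 - z) * 1.
  by rewrite ler_wpM2l// subr_ge0.
have -> : e = z * (e * (1 + l * (1 - z))) + (1 - z) * (e * (1 - l * z)) by ring.
lra.
Qed.

(** The power t^r lies between 1 and t. At t = 0 it is 1 or 0 according to whether r = 0, which is
    treated apart. *)
Lemma distr_powR1_le t r : 0 <= t -> 0 <= r <= 1 -> `|t `^ r - 1| <= `|t - 1|.
Proof.
move=> t0 /andP[r0 r1]; have [t1|t1] := leP 1 t.
  have h : t `^ r <= t by exact: ler1_powR.
  have h' : 1 <= t `^ r.
    by rewrite -[leLHS](powRr0 t); exact: ler_powR.
  rewrite !ger0_norm; lra.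
have := t0; rewrite le_eqVlt => /predU1P[<-|tp].
  rewrite sub0r normrN1 /powR eqxx; case: eqP => _; rewrite ?subrr ?normr0//.
  by rewrite sub0r normrN1.
have h : t <= t `^ r by apply: ger1_powR => //; lra.
have h' : t `^ r <= 1.
  by rewrite -[leRHS](powRr0 t); apply: ger_powR => //; lra.
rewrite !ler0_norm; lra.
Qed.

(** Homogeneity reduces this to base point 1. The implied Lipschitz factor m^(r - 1) is the right
    one when [m] is not too small. *)
Lemma distr_powR_le a m r : 0 <= a -> 0 < m -> 0 <= r <= 1 ->
  `|a `^ r - m `^ r| <= m `^ r * `|a / m - 1|.
Proof.
move=> a0 m0 r01.
have am : 0 <= a / m by rewrite divr_ge0// ltW.
have -> : a `^ r = m `^ r * (a / m) `^ r.
  by rewrite -powRM ?(ltW m0)//; congr (_ `^ _); field; rewrite gt_eqF.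
rewrite -{2}[m `^ r]mulr1 -mulrBr normrM ger0_norm ?powR_ge0//.
by rewrite ler_wpM2l ?powR_ge0// distr_powR1_le.
Qed.

(* Below [s] both roots are [O(s `^ p^-1)]; above [s] the deviation is
   [sqrt (s * m)] and the root is [m `^ (p^-1 - 1)]-Lipschitz. *)
Lemma distr_root_le p s m a : 1 <= p -> 0 < s <= 1 -> 0 <= m <= 1 -> 0 <= a ->
  `|a - m| <= 3 * Num.sqrt (s * Num.max m s) ->
  `|a `^ p^-1 - m `^ p^-1| <= 4 * s `^ (Num.max 2 p)^-1.
Proof.
move=> p1 /andP[s0 s1] /andP[m0 m1] a0 ham.
have p0 : 0 < p by lra.
have r0 : 0 < p^-1 by rewrite invr_gt0.
have r1 : p^-1 <= 1 by rewrite invf_le1.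
set q := Num.max 2 p.
have q2 : 2 <= q by rewrite le_max lexx.
have qp : p <= q by rewrite le_max lexx orbT.
have q0 : 0 < q by lra.
(* As s <= 1, larger exponents give smaller powers, so each power of [s] met below is absorbed into
   s^(1/q). *)
have sq r : q^-1 <= r -> s `^ r <= s `^ q^-1.
  by move=> h; apply: ger_powR => //; rewrite s0.
have [ms|sm] := leP m s.
  have hmx : Num.max m s = s by apply/max_idPr.
  rewrite hmx -expr2 sqrtr_sqr (gtr0_norm s0) in ham.
  have a4 : a <= 4 * s by move: ham; rewrite ler_norml => /andP[]; lra.
  have s4 : s `^ p^-1 <= s `^ q^-1 by apply: sq; rewrite lef_pV2.
  have h1 : a `^ p^-1 <= 4 * s `^ p^-1.
    apply: (@le_trans _ _ ((4 * s) `^ p^-1)).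
      by apply: ge0_ler_powR; rewrite ?nnegrE ?subr_ge0//; lra.
    rewrite powRM//; last exact: ltW.
    by rewrite ler_wpM2r ?powR_ge0//; apply: ler1_powR => //; lra.
  have h2 : m `^ p^-1 <= s `^ p^-1.
    by apply: ge0_ler_powR; rewrite ?nnegrE ?subr_ge0//; lra.
  have h3 := powR_ge0 a p^-1; have h4 := powR_ge0 m p^-1.
  have h5 := powR_ge0 s p^-1.
  by rewrite ler_norml; apply/andP; split; lra.
have mp : 0 < m by lra.
have hmx : Num.max m s = m by apply/max_idPl; exact: ltW.
rewrite hmx in ham.
apply: (le_trans (distr_powR_le a0 mp _)); first by rewrite (ltW r0).
have -> : a / m - 1 = (a - m) / m by field; rewrite gt_eqF.
rewrite normrM (gtr0_norm (x := m^-1)) ?invr_gt0//.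
have hd : `|a - m| / m <= 3 * (s / m) `^ 2^-1.
  rewrite ler_pdivrMr//; apply: (le_trans ham).
  rewrite -mulrA ler_wpM2l//.
  have -> : s * m = (s / m) * (m * m) by field; rewrite gt_eqF.
  have sm0 : 0 <= s / m by rewrite divr_ge0// ltW.
  by rewrite sqrtrM// powR12_sqrt// -expr2 sqrtr_sqr gtr0_norm.
apply: (@le_trans _ _ (m `^ p^-1 * (3 * (s / m) `^ 2^-1))).
  by rewrite ler_wpM2l ?powR_ge0.
rewrite mulrCA; apply: (@le_trans _ _ (3 * s `^ q^-1)); last first.
  by rewrite ler_wpM2r ?powR_ge0//; lra.
rewrite ler_wpM2l//.
rewrite powRM; [|lra|by rewrite invr_ge0 ltW].
rewrite -(powR_inv1 (ltW mp)) -powRrM mulN1r mulrCA.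
rewrite -powRD; last by rewrite (gt_eqF mp) implybT.
(* What remains is s^(1/2) m^(1/p - 1/2). For p <= 2 the power of [m] is at most 1; for p > 2 its
   exponent is negative, and m > s bounds the product by s^(1/p). *)
have [r2|r2] := leP 2^-1 p^-1.
  rewrite -[leRHS]mulr1 ler_pM ?powR_ge0//.
    by apply: sq; rewrite lef_pV2// posrE.
  by rewrite -[leRHS](powRr0 m); apply: ger_powR; rewrite ?mp// subr_ge0.
have h : m `^ (p^-1 - 2^-1) <= s `^ (p^-1 - 2^-1).
  rewrite -(opprB (2^-1)) !powRN lef_pV2 ?posrE ?powR_gt0//.
  by apply: ge0_ler_powR; rewrite ?nnegrE ?subr_ge0//; lra.
apply: (@le_trans _ _ (s `^ 2^-1 * s `^ (p^-1 - 2^-1))).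
  by rewrite ler_wpM2l ?powR_ge0.
rewrite -powRD; last by rewrite (gt_eqF s0) implybT.
by apply: sq; rewrite addrC subrK lef_pV2.
Qed.

End real_inequalities.

(* Unlike [ge0_le_integral], no measurability is needed: the integral is a
   supremum over the simple functions below. *)
Lemma le_integral_ge0 d (T : measurableType d) (R : realType)
    (mu : {measure set T -> \bar R}) (f g : T -> \bar R) :
  (forall x, 0 <= f x)%E -> (forall x, f x <= g x)%E ->
  (\int[mu]_x f x <= \int[mu]_x g x)%E.
Proof.
move=> f0 fg; have g0 x : (0 <= g x)%E by exact: le_trans (f0 x) (fg x).
rewrite !ge0_integralTE//; apply: le_ereal_sup => _ [h hf <-].
by exists h => // x; exact: le_trans (hf x) (fg x).
Qed.

Lemma bounded_integrable d (T : measurableType d) (R : realType)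
    (mu : {measure set T -> \bar R}) (f : T -> R) (M : R) :
  mu [set: T] = 1%E -> measurable_fun [set: T] f -> (forall x, `|f x| <= M) ->
  mu.-integrable [set: T] (EFin \o f).
Proof.
move=> mu1 mf fM; apply: measurable_bounded_integrable => //.
  by rewrite mu1 ltry.
by exists M; split; [exact: num_real|move=> M' /ltW MM' x _; exact: le_trans MM'].
Qed.

Lemma EFin_Rintegral d (T : measurableType d) (R : realType)
    (mu : {measure set T -> \bar R}) (f : T -> R) :
  mu.-integrable [set: T] (EFin \o f) ->
  (\int[mu]_x (f x)%:E = (\int[mu]_x f x)%:E)%E.
Proof. by move=> fi; rewrite /Rintegral fineK//; exact: integrable_fin_num. Qed.

Lemma integral_cst1 d (T : measurableType d) (R : realType)
    (mu : {measure set T -> \bar R}) (r : R) :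
  mu [set: T] = 1%E -> (\int[mu]_x r%:E = r%:E)%E.
Proof. by move=> mu1; rewrite integral_cst// mu1 mule1. Qed.

(** * Chernoff bounds for product measures *)

Section power_prob_theory.
Context d (T : measurableType d) (R : realType) (P : probability T R).

(** Stated for arbitrary sets because the events of interest involve risks, suprema whose
    measurability in the sample is not established. The power is an iterated integral of sections,
    so [le_integral_ge0] gives the induction step. *)
Lemma le_power_prob n (A B : set (n.-tuple T)) :
  A `<=` B -> (power_prob P n A <= power_prob P n B)%E.
Proof.
elim: n A B => [|n IHn] A B AB.
  rewrite /= !diracE lee_fin ler_nat.
  by case: (boolP (_ \in A)) => // /set_mem /AB h; rewrite mem_set.
rewrite /= /distribution /pushforward /product_measure1.
apply: le_integral_ge0 => x /=; first exact: measure_ge0.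
by apply: IHn => w; rewrite /xsection/= !inE; exact: AB.
Qed.

Lemma measurable_prod_tnth n (g : T -> R) : measurable_fun [set: T] g ->
  measurable_fun [set: n.-tuple T] (fun w => \prod_(i < n) g (tnth w i)).
Proof.
move=> mg; apply: measurable_prod => i _.
by apply: measurableT_comp => //; exact: measurable_tnth.
Qed.

(** Independence: Tonelli's theorem peels off the first coordinate. It serves to tensorize the
    moment generating function. *)
Lemma integral_power_prob_prod n (g : T -> R) (G : R) :
  measurable_fun [set: T] g -> (forall x, 0 <= g x) ->
  (\int[P]_x (g x)%:E <= G%:E)%E ->
  (\int[power_prob P n]_w (\prod_(i < n) g (tnth w i))%:E <= (G ^+ n)%:E)%E.
Proof.
move=> mg g0 gG.
have G0 : 0 <= G.
  by rewrite -lee_fin (le_trans _ gG)// integral_ge0// => x _; rewrite lee_fin.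
have pg0 m (w : m.-tuple T) : 0 <= \prod_(i < m) g (tnth w i).
  by apply: prodr_ge0 => i _.
elim: n => [|n IHn].
  under eq_integral do rewrite big_ord0.
  by rewrite integral_dirac// diracT mul1e expr0.
have mp : measurable_fun [set: n.+1.-tuple T]
  (fun w => \prod_(i < n.+1) g (tnth w i)) by exact: measurable_prod_tnth.
rewrite [power_prob P n.+1]/= ge0_integral_distribution//; last 2 first.
- exact/measurable_EFinP.
- by move=> w; rewrite lee_fin.
rewrite fubini_tonelli1/=; last 2 first.
- by apply: measurableT_comp; [exact/measurable_EFinP|exact: measurable_tuple_cons].
- by move=> x; rewrite lee_fin; exact: pg0.
have splitE x : fubini_F (power_prob P n)
    ((fun w => (\prod_(i < n.+1) g (tnth w i))%:E) \o @tuple_cons _ T n) x =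
    ((g x)%:E * \int[power_prob P n]_w (\prod_(i < n) g (tnth w i))%:E)%E.
  rewrite -ge0_integralZl_EFin//; last 2 first.
  - by move=> w _; rewrite lee_fin.
  - by apply/measurable_EFinP; exact: measurable_prod_tnth.
  apply: eq_integral => w _; rewrite /= big_ord_recl -EFinM.
  by congr (_ * _)%:E; apply: eq_bigr => i _; rewrite tnthS.
under eq_integral do rewrite splitE.
apply: (@le_trans _ _ (\int[P]_x ((g x)%:E * (G ^+ n)%:E))%E).
  apply: le_integral_ge0 => x; last by rewrite lee_wpmul2l// lee_fin.
  by rewrite mule_ge0 ?lee_fin// integral_ge0// => w _; rewrite lee_fin.
rewrite ge0_integralZr//; last 3 first.
- exact/measurable_EFinP.
- by move=> x _; rewrite lee_fin.
- by rewrite lee_fin exprn_ge0.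
by rewrite exprS EFinM lee_wpmul2r// lee_fin exprn_ge0.
Qed.

Definition sample_mean n (Z : T -> R) (w : n.-tuple T) : R :=
  n%:R^-1 * \sum_(i < n) Z (tnth w i).

Lemma measurable_sample_mean n (Z : T -> R) : measurable_fun [set: T] Z ->
  measurable_fun [set: n.-tuple T] (sample_mean Z).
Proof.
move=> mZ; apply: measurable_funM => //; apply: measurable_sum => i.
by apply: measurableT_comp => //; exact: measurable_tnth.
Qed.

Section bounded_sample.
Variables (Z : T -> R) (m : R).
Hypothesis mZ : measurable_fun [set: T] Z.
Hypothesis Z01 : forall x, 0 <= Z x <= 1.
Hypothesis Zm : (\int[P]_x (Z x)%:E = m%:E)%E.

Lemma mean_itv01 : 0 <= m <= 1.
Proof.
rewrite -!lee_fin -Zm; apply/andP; split.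
  by apply: integral_ge0 => x _; rewrite lee_fin; case/andP: (Z01 x).
rewrite (le_trans (le_integral_ge0 (g := fun=> 1%:E) _ _ _))//.
- by move=> x; rewrite lee_fin; case/andP: (Z01 x).
- by move=> x; rewrite lee_fin; case/andP: (Z01 x).
- by rewrite (integral_cst1 _ (probability_setT P)).
Qed.

(** The chord bound gives 1 + m (e^l - 1), then 1 + y <= e^y is applied. The quadratic term carries
    the factor [m], which is what makes the deviation bound sharp for small means. *)
Lemma integral_expR_le (l : R) : l <= 2^-1 ->
  (\int[P]_x (expR (l * Z x))%:E <= (expR (m * l + 2 * m * l ^+ 2))%:E)%E.
Proof.
move=> l2; have /andP[m0 m1] := mean_itv01.
have iZ : P.-integrable [set: T] (EFin \o Z).
  apply: (@bounded_integrable _ _ _ _ _ 1) => //; first exact: probability_setT.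
  by move=> x; have /andP[h1 h2] := Z01 x; rewrite ger0_norm.
apply: (@le_trans _ _ (\int[P]_x (1 + (expR l - 1) * Z x)%:E)%E).
  apply: le_integral_ge0 => x; rewrite lee_fin ?expR_ge0//.
  by rewrite mulrC [_ * Z x]mulrC mulrC; exact: expR_le_chord.
under eq_integral do rewrite EFinD EFinM.
rewrite integralD//; last 2 first.
- exact: finite_measure_integrable_cst.
- exact: integrableZl.
rewrite (integral_cst1 _ (probability_setT P)) integralZl// Zm -EFinM -EFinD.
rewrite lee_fin.
have := expR_le_quad l2 => hl.
apply: (@le_trans _ _ (1 + m * (l + 2 * l ^+ 2))).
  by rewrite lerD2l mulrC ler_wpM2l//; lra.
rewrite (_ : m * l + _ = m * (l + 2 * l ^+ 2)); first exact: expR_ge1Dx.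
by ring.
Qed.

(** Markov's inequality for the product of the exponentials. The sign of [l] is free, so both tails
    are covered. *)
Lemma chernoff n (l b : R) : (0 < n)%N -> l <= 2^-1 ->
  (power_prob P n [set w | (m * l + 2 * m * l ^+ 2 + b <= l * sample_mean Z w)%R]
    <= (expR (- (n%:R * b)))%:E)%E.
Proof.
move=> n0 l2; set c := m * l + _.
have nR : n%:R != 0 :> R by rewrite pnatr_eq0 -lt0n.
pose F (w : n.-tuple T) := \prod_(i < n) expR (l * Z (tnth w i)).
have mexp : measurable_fun [set: T] (fun x => expR (l * Z x)).
  by apply: measurableT_comp => //; apply: measurable_funM.
have FE w : F w = expR (n%:R * (l * sample_mean Z w)).
  rewrite /F -expR_sum; congr expR; rewrite /sample_mean -mulr_sumr.
  by rewrite mulrCA mulVKf.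
have F0 w : 0 <= F w by rewrite FE expR_ge0.
have iF : (\int[power_prob P n]_w (F w)%:E <= (expR (n%:R * c))%:E)%E.
  rewrite expRM_natl.
  apply: (@integral_power_prob_prod n (fun x => expR (l * Z x))) => //.
  exact: integral_expR_le.
set a := expR (n%:R * (c + b)).
have a0 : 0 < a by exact: expR_gt0.
have mF : measurable_fun [set: n.-tuple T] (EFin \o F).
  by apply/measurable_EFinP; exact: (@measurable_prod_tnth n (fun x => expR (l * Z x))).
have := le_integral_abse (power_prob P n) measurableT mF a0.
rewrite setTI (_ : [set x | _] = [set w | c + b <= l * sample_mean Z w]);
  last first.
  apply/seteqP; split => w /=; rewrite lee_fin (ger0_norm (F0 w)) FE ler_expR
    ler_pM2l ?ltr0n//.
under eq_integral do rewrite /= (ger0_norm (F0 _)).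
move=> /le_trans /(_ iF); rewrite -lee_pdivlMl// => /le_trans; apply.
rewrite -EFinM lee_fin /a -expRN -expRD le_eqVlt; apply/orP; left.
by apply/eqP; congr expR; ring.
Qed.

Lemma sample_mean_deviation n (s : R) : (0 < n)%N -> 0 < s ->
  (power_prob P n
     [set w | (3 * Num.sqrt (s * Num.max m s) < `|sample_mean Z w - m|)%R]
   <= (2 * expR (- (n%:R * s)))%:E)%E.
Proof.
move=> n0 s0; have /andP[m0 m1] := mean_itv01.
set M := Num.max m s.
have sM : s <= M by rewrite le_max lexx orbT.
have mM : m <= M by rewrite le_max lexx.
have M0 : 0 < M by exact: lt_le_trans sM.
(* With this [l], a deviation 3 sqrt(s M) contributes 3 s / 2 to the exponent and the quadratic term
   costs at most s / 2, leaving [s]. Replacing [m] by M = max(m, s) keeps l <= 1/2. *)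
pose l := Num.sqrt (s / M) / 2.
have sM0 : 0 <= s / M by rewrite divr_ge0// ltW.
have l0 : 0 < l by rewrite /l divr_gt0// sqrtr_gt0 divr_gt0.
have l2 : l <= 2^-1.
  rewrite /l -[leRHS]mul1r ler_pM2r ?invr_gt0//.
  rewrite -[leRHS]sqrtr1 ler_sqrt// ler_pdivrMr// mul1r//.
have lsq : l ^+ 2 = s / M / 4.
  rewrite /l expr_div_n sqr_sqrtr//; congr (_ / _).
  by rewrite -natrX.
have lsM : l * Num.sqrt (s * M) = s / 2.
  rewrite /l mulrAC -sqrtrM//.
  rewrite (_ : s / M * (s * M) = s * s); last by field; rewrite gt_eqF.
  by rewrite -expr2 sqrtr_sqr gtr0_norm.
have key : 2 * m * l ^+ 2 <= s / 2.
  rewrite lsq (_ : 2 * m * _ = (m / M) * (s / 2)); last by field; rewrite gt_eqF.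
  by rewrite ler_piMl//; [lra|rewrite ler_pdivrMr// mul1r].
pose U (e : R) : set (n.-tuple T) :=
  [set w | m * e + 2 * m * e ^+ 2 + s <= e * sample_mean Z w].
have mU e : measurable (U e).
  rewrite /U -[X in measurable X]setTI.
  apply: measurable_fun_le => //; apply: measurable_funM => //.
  exact: measurable_sample_mean.
apply: (@le_trans _ _ (power_prob P n (U l `|` U (- l)))).
  apply: le_power_prob => w /=; rewrite lter_normr => /orP[] h.
  - left; rewrite /U/=; have := ltW h; rewrite -(ler_pM2l l0).
    by rewrite mulrCA lsM mulrBr [l * m]mulrC; lra.
  - right; rewrite /U/=; have := ltW h; rewrite -(ler_pM2l l0).
    by rewrite sqrrN mulrCA lsM opprB mulrBr [l * m]mulrC; lra.
rewrite (le_trans (measureU2 _ (mU _) (mU _)))//.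
rewrite mulr2n mulrDl mul1r EFinD leeD//; apply: chernoff => //.
lra.
Qed.

End bounded_sample.

(** Union bound over the [N] two-sided deviations. *)
Lemma sample_means_uniform n N (Z : 'I_N -> T -> R) (m : 'I_N -> R) (s : R) :
  (0 < n)%N -> 0 < s ->
  (forall j, measurable_fun [set: T] (Z j)) ->
  (forall j x, 0 <= Z j x <= 1) ->
  (forall j, \int[P]_x (Z j x)%:E = (m j)%:E)%E ->
  ((1 - N%:R * (2 * expR (- (n%:R * s))))%:E <= power_prob P n
    [set w | forall j, (`|sample_mean (Z j) w - m j|
      <= 3 * Num.sqrt (s * Num.max (m j) s))%R])%E.
Proof.
move=> n0 s0 mZ Z01 Zm.
pose D j : set (n.-tuple T) :=
  [set w | 3 * Num.sqrt (s * Num.max (m j) s) < `|sample_mean (Z j) w - m j|].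
have mD j : measurable (D j).
  rewrite (_ : D j = ~` [set w |
      `|sample_mean (Z j) w - m j| <= 3 * Num.sqrt (s * Num.max (m j) s)]); last first.
    by apply/seteqP; split => w; rewrite /D/= ltNge => /negP.
  apply: measurableC; rewrite -[X in measurable X]setTI.
  apply: measurable_fun_le => //.
  apply: measurableT_comp => //; apply: measurable_funB => //.
  exact: measurable_sample_mean.
pose U := \bigcup_(j in [set: 'I_N]) D j.
have UE : U = \big[setU/set0]_(j <- index_enum 'I_N) D j.
  rewrite -bigcup_seq; congr (bigcup _ _); apply/seteqP; split => j //= _.
  exact: mem_index_enum.
have mU : measurable U by rewrite UE; exact: bigsetU_measurable.
have hU : (power_prob P n U <= (N%:R * (2 * expR (- (n%:R * s))))%:E)%E.
  rewrite UE mulr_natl -[X in (_ *+ X)](card_ord N) -sumr_const -sumEFin.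
  elim: (index_enum _) => [|j r IHr]; first by rewrite !big_nil measure0.
  rewrite !big_cons (le_trans (measureU2 _ _ _))//; first exact: bigsetU_measurable.
  by rewrite leeD//; exact: sample_mean_deviation.
rewrite (_ : [set w | _] = ~` U); last first.
  apply/seteqP; split => w /=.
    by move=> h [j _] /=; rewrite /D/= ltNge h.
  by move=> h j; rewrite leNgt; apply/negP => hj; apply: h; exists j.
rewrite probability_setC// EFinB.
by rewrite leeB.
Qed.

End power_prob_theory.

(** * Moments of the excess and their continuity in [eta] *)

Lemma continuous_pos_part_powR (R : realType) (q : R) : 0 < q ->
  continuous (fun y : R => Num.max y 0 `^ q).
Proof.
move=> q0 y; have [y0|y0] := leP y 0.
  (* The value at y <= 0 is 0, and the radius e^(1/q) keeps nearby values below [e]. This includes y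
     = 0, where differentiability may fail. *)
  apply/cvgrPdist_lt => e e0.
  have d0 : 0 < e `^ q^-1 by exact: powR_gt0.
  near=> z.
  have yz : `|y - z| < e `^ q^-1.
    by near: z; apply: (@cvgr_dist_lt _ _ _ _ _ id); [exact: cvg_id|exact: d0].
  rewrite (max_idPr y0) powR0 ?gt_eqF// sub0r normrN ger0_norm ?powR_ge0//.
  have eE : e = (e `^ q^-1) `^ q by rewrite -powRrM mulVf ?gt_eqF// powRr1// ltW.
  rewrite [ltRHS]eE.
  apply: gt0_ltr_powR => //; rewrite ?nnegrE ?le_max ?lexx ?orbT ?powR_ge0//.
  rewrite gt_max d0 andbT; move: yz; rewrite ltr_norml; lra.
have h : {for y, continuous (@powR R ^~ q)}.
  apply: differentiable_continuous; apply/derivable1_diffP.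
  by apply: derivable_powR; rewrite in_itv/= y0.
apply: cvg_trans; last first.
  by rewrite (max_idPl (ltW y0)); exact: h.
apply: near_eq_cvg; near=> z.
rewrite (max_idPl _)//; apply: ltW; near: z.
exact: lt_nbhsr.
Unshelve. all: by end_near. Qed.

Section excess_moment.
Context d (T : measurableType d) (R : realType).
Variables (mu : {measure set T -> \bar R}) (X : T -> R) (B : R).
Hypothesis mu1 : mu [set: T] = 1%E.
Hypothesis mX : measurable_fun [set: T] X.
Hypothesis XB : forall x, `|X x| <= B.

Definition excess (eta : R) (x : T) : R := Num.max (X x - eta) 0.

Definition excess_moment (q eta : R) : R := \int[mu]_x (excess eta x `^ q).

Lemma excess_ge0 eta x : 0 <= excess eta x.
Proof. by rewrite le_max lexx orbT. Qed.

Lemma excess_ge eta x : X x - eta <= excess eta x.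
Proof. by rewrite le_max lexx. Qed.

Lemma excess_le eta x : eta <= B -> excess eta x <= B - eta.
Proof.
move=> eB; rewrite ge_max subr_ge0 eB andbT lerD2r.
exact: le_trans (ler_norm _) (XB x).
Qed.

Lemma excess_le_norm eta x : excess eta x <= B + `|eta|.
Proof.
have h := XB x; have hx := ler_norm (X x); have he := ler_norm (- eta).
rewrite normrN in he; rewrite ge_max; apply/andP; split; first by lra.
by rewrite addr_ge0// (le_trans _ h).
Qed.

Lemma measurable_excess eta : measurable_fun [set: T] (excess eta).
Proof. by apply: measurable_maxr => //; exact: measurable_funB. Qed.

Lemma measurable_excess_powR q eta :
  measurable_fun [set: T] (fun x => excess eta x `^ q).
Proof.
by apply: (measurableT_comp (measurable_powR q)); exact: measurable_excess.
Qed.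

Lemma excess_powR_le q eta x : 0 <= q ->
  `|excess eta x `^ q| <= (B + `|eta|) `^ q.
Proof.
move=> q0; rewrite ger0_norm ?powR_ge0//.
have h := excess_le_norm eta x; have h0 := excess_ge0 eta x.
by apply: ge0_ler_powR; rewrite ?nnegrE//; exact: le_trans h.
Qed.

Lemma integrable_excess_powR q eta : 0 <= q ->
  mu.-integrable [set: T] (EFin \o (fun x => excess eta x `^ q)).
Proof.
move=> q0; apply: (bounded_integrable mu1).
  exact: measurable_excess_powR.
by move=> x; exact: excess_powR_le.
Qed.

Lemma excess_momentE q eta : 0 <= q ->
  (\int[mu]_x (excess eta x `^ q)%:E = (excess_moment q eta)%:E)%E.
Proof.
by move=> q0; apply: EFin_Rintegral; exact: integrable_excess_powR.
Qed.

Lemma excess_moment_ge0 q eta : 0 <= excess_moment q eta.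
Proof. by apply: Rintegral_ge0 => x _; exact: powR_ge0. Qed.

Lemma Rintegral_cst1 (r : R) : \int[mu]_x r = r.
Proof. by rewrite Rintegral_cst// mu1 mulr1. Qed.

Lemma integrable_cst1 (r : R) : mu.-integrable [set: T] (EFin \o (fun=> r)).
Proof. by apply: (bounded_integrable (M := `|r|)). Qed.

Lemma excess_moment_le q eta (a : R) : 0 <= q -> 0 <= a ->
  (forall x, excess eta x <= a) -> excess_moment q eta <= a `^ q.
Proof.
move=> q0 a0 h; rewrite -[leRHS]Rintegral_cst1; apply: le_Rintegral => //.
- exact: integrable_excess_powR.
- exact: integrable_cst1.
- move=> x _; apply: ge0_ler_powR; rewrite ?nnegrE//; exact: excess_ge0.
Qed.

Lemma excess_moment_ge q eta (a : R) : 0 <= q -> 0 <= a ->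
  (forall x, a <= excess eta x) -> a `^ q <= excess_moment q eta.
Proof.
move=> q0 a0 h; rewrite -[leLHS]Rintegral_cst1; apply: le_Rintegral => //.
- exact: integrable_cst1.
- exact: integrable_excess_powR.
- move=> x _; apply: ge0_ler_powR; rewrite ?nnegrE//; exact: excess_ge0.
Qed.

Lemma excess_moment_anti q eta eta' : 0 <= q -> eta <= eta' ->
  excess_moment q eta' <= excess_moment q eta.
Proof.
move=> q0 ee; apply: le_Rintegral => //; [exact: integrable_excess_powR..|].
move=> x _; apply: ge0_ler_powR; rewrite ?nnegrE ?excess_ge0//.
by rewrite ge_max excess_ge0 andbT (le_trans _ (excess_ge _ _))// lerB.
Qed.

(** The excess is bounded, so its power [q] is at most a constant times its power [q - 1]. *)
Lemma excess_moment_eq0 q eta : 1 < q ->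
  excess_moment (q - 1) eta = 0 -> excess_moment q eta = 0.
Proof.
move=> q1 N0; have q0 : 0 < q by lra.
have q10 : 0 <= q - 1 by lra.
apply/eqP; rewrite eq_le excess_moment_ge0 andbT.
rewrite -[leRHS](mulr0 (B + `|eta|)) -N0 -RintegralZl//; last first.
  exact: integrable_excess_powR.
apply: le_Rintegral => //.
- by apply: integrable_excess_powR; exact: ltW.
- exact: (integrableZl measurableT _ (integrable_excess_powR eta q10)).
- move=> x _; rewrite -(mulr_powRB1 (excess_ge0 eta x) q0).
  by rewrite ler_wpM2r ?powR_ge0// excess_le_norm.
Qed.

Lemma continuous_excess_moment q : 0 < q -> continuous (excess_moment q).
Proof.
move=> q0 eta; rewrite /excess_moment.
(* Dominated convergence on a bounded neighbourhood of [eta], with a constant as dominating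
   function. *)
set M := `|eta| + 1.
have B0 : 0 <= B by exact: le_trans (XB point).
have Meta : eta \in `]- M, M[%classic.
  rewrite inE/= in_itv/= -ltr_norml /M; lra.
apply: (continuity_under_integral (f := fun e x => excess e x `^ q) measurableT
  (u := - M) (v := M) _ _ (g := fun=> (B + M) `^ q)) Meta.
- by move=> e _; apply: integrable_excess_powR; exact: ltW.
- apply: aeW => x _ e _.
  apply: (@continuous_comp _ _ _ (fun e => X x - e) (fun y => Num.max y 0 `^ q)).
    by apply: cvgB; [exact: cvg_cst|exact: cvg_id].
  exact: continuous_pos_part_powR.
- exact: integrable_cst1.
- move=> e /=; rewrite in_itv/= -ltr_norml => eM; apply: aeW => x _.
  apply: (le_trans (excess_powR_le _ _ (ltW q0))).
  apply: ge0_ler_powR; rewrite ?nnegrE; last by lra.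
  + exact: ltW.
  + by rewrite addr_ge0.
  + by rewrite addr_ge0// /M addr_ge0.
Qed.

End excess_moment.

(** * Duality for the risk when [k > 1] *)

Section dual.
Context (R : realType).
Variables (k tau : R).
Hypotheses (k1 : 1 < k) (tau0 : 0 < tau).

Definition conj_exp : R := k / (k - 1).

(* The divergence constraint on a density [zeta] of mean [1] reads
   [\int zeta `^ k <= dual_radius `^ k]. *)
Definition dual_radius : R := (1 + k * (k - 1) * tau) `^ k^-1.

Local Notation p := conj_exp.
Local Notation c := dual_radius.

Let k0 : 0 < k. Proof. exact: lt_trans k1. Qed.
Let k10 : 0 < k - 1. Proof. by rewrite subr_gt0. Qed.
Let kk0 : 0 < k * (k - 1). Proof. exact: mulr_gt0. Qed.

Lemma conj_exp_gt1 : 1 < p.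
Proof. by rewrite /p ltr_pdivlMr// mul1r; lra. Qed.

Let p0 : 0 < p. Proof. exact: lt_trans conj_exp_gt1. Qed.
Let p10 : 0 < p - 1. Proof. by rewrite subr_gt0 conj_exp_gt1. Qed.

Lemma conj_expB1 : (p - 1) * k = p.
Proof. by rewrite /p; field; rewrite gt_eqF. Qed.

Lemma conj_expV : p^-1 + k^-1 = 1.
Proof. by rewrite /p; field; rewrite !gt_eqF. Qed.

Lemma dual_radius_powR : c `^ k = 1 + k * (k - 1) * tau.
Proof.
have h : 0 <= 1 + k * (k - 1) * tau by rewrite addr_ge0// ltW// mulr_gt0.
by rewrite /c -powRrM mulVf ?gt_eqF// powRr1.
Qed.

Lemma dual_radius_gt1 : 1 < c.
Proof.
rewrite -[ltLHS](_ : 1 `^ k^-1 = 1); last by rewrite powR1.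
apply: gt0_ltr_powR; rewrite ?invr_gt0 ?nnegrE//.
  by rewrite addr_ge0// ltW// mulr_gt0.
by rewrite ltrDl mulr_gt0.
Qed.

Let c0 : 0 < c. Proof. exact: lt_trans dual_radius_gt1. Qed.

Lemma phi_powerE x : 0 <= x ->
  phi_power k x = ((x `^ k - k * x + k - 1) / (k * (k - 1)))%:E.
Proof. by move=> x0; rewrite /phi_power ltNge x0 (ltNge k) (ltW k0) andbF. Qed.

(** Young's inequality for the product of [x] and 1. *)
Lemma phi_power_ge0 x : 0 <= x -> 0 <= (x `^ k - k * x + k - 1) / (k * (k - 1)).
Proof.
move=> x0; rewrite divr_ge0//; last exact: ltW.
have := @conjugate_powR R x 1 k p x0 ler01 k0 p0.
rewrite addrC conj_expV powR1 mulr1 => /(_ erefl) h.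
have : k * x <= k * (x `^ k / k + 1 / p) by rewrite ler_pM2l.
rewrite (_ : k * (_ + _) = x `^ k + (k - 1)); first by lra.
by rewrite /p; field; rewrite !gt_eqF.
Qed.

Section fixed_measure.
Context d (T : measurableType d).
Variables (mu : {measure set T -> \bar R}) (X : T -> R) (B : R).
Hypothesis mu1 : mu [set: T] = 1%E.
Hypothesis mX : measurable_fun [set: T] X.
Hypothesis XB : forall x, `|X x| <= B.

Local Notation V := (excess_moment mu X p).
Local Notation N := (excess_moment mu X (p - 1)).

Definition dual_objective (eta : R) : R := eta + c * V eta `^ p^-1.

Lemma integrable_density (zeta : T -> R) : measurable_fun [set: T] zeta ->
  (forall x, 0 <= zeta x) -> (\int[mu]_x (zeta x)%:E = 1)%E ->
  mu.-integrable [set: T] (EFin \o zeta) /\ \int[mu]_x zeta x = 1.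
Proof.
move=> mz z0 z1; split; last by rewrite /Rintegral z1.
apply/integrableP; split; first exact/measurable_EFinP.
by under eq_integral do rewrite /= ger0_norm//; rewrite z1 ltry.
Qed.

(** From x^k + (k - 1) = k (k - 1) phi(x) + k x. All terms are kept nonnegative, so the integrals
    can be split in the extended reals before zeta^k is known to be integrable. *)
Lemma admissible_powR (zeta : T -> R) : admissible_density (phi_power k) tau mu zeta ->
  mu.-integrable [set: T] (EFin \o (fun x => zeta x `^ k)) /\
  \int[mu]_x (zeta x `^ k) <= c `^ k.
Proof.
move=> [mz z0 z1 zphi].
have mzk : measurable_fun [set: T] (fun x => zeta x `^ k).
  exact: (measurableT_comp (measurable_powR k)).
have mphi : measurable_fun [set: T]
    (fun x => (zeta x `^ k - k * zeta x + k - 1) / (k * (k - 1))).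
  apply: measurable_funM => //; apply: measurable_funB => //.
  apply: measurable_funD => //; apply: measurable_funB => //.
  exact: measurable_funM.
have le : (\int[mu]_x (zeta x `^ k)%:E <= (c `^ k)%:E)%E.
  apply: (@le_trans _ _ (\int[mu]_x ((k * (k - 1))%:E * phi_power k (zeta x)
      + k%:E * (zeta x)%:E) - (k - 1)%:E)%E).
    rewrite leeBrDr// -[X in (_ + X)%E](integral_cst1 _ mu1) -ge0_integralD//.
    - apply: le_integral_ge0 => x.
        by rewrite adde_ge0// lee_fin ?powR_ge0// ltW.
      rewrite phi_powerE// -!EFinM -!EFinD lee_fin mulrC divfK ?gt_eqF//; lra.
    - by move=> x _; rewrite lee_fin powR_ge0.
    - exact/measurable_EFinP.
    - by move=> x _; rewrite lee_fin ltW.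
  under eq_integral do rewrite phi_powerE//.
  rewrite ge0_integralD//; last 4 first.
  - by move=> x _; rewrite -EFinM lee_fin mulr_ge0 ?phi_power_ge0// ltW.
  - by apply: measurable_funeM; exact/measurable_EFinP.
  - by move=> x _; rewrite -EFinM lee_fin mulr_ge0// ltW.
  - by apply: measurable_funeM; exact/measurable_EFinP.
  rewrite !ge0_integralZl_EFin//; last 6 first.
  - by move=> x _; rewrite lee_fin.
  - exact/measurable_EFinP.
  - exact: ltW.
  - by move=> x _; rewrite lee_fin phi_power_ge0.
  - exact/measurable_EFinP.
  - exact: ltW.
  rewrite z1 mule1 leeBlDr// dual_radius_powR -EFinD.
  rewrite (_ : 1 + _ + _ = k * (k - 1) * tau + k); last by ring.
  rewrite EFinD leeD2r// [leRHS]EFinM lee_pmul2l ?lte_fin//.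
  by move: zphi; under eq_integral do rewrite phi_powerE//.
have int : mu.-integrable [set: T] (EFin \o (fun x => zeta x `^ k)).
  apply/integrableP; split; first exact/measurable_EFinP.
  under eq_integral do rewrite /= ger0_norm ?powR_ge0//.
  exact: le_lt_trans le (ltry _).
by split => //; rewrite -lee_fin -EFin_Rintegral.
Qed.

(** Weak duality: X zeta <= eta zeta + (X - eta)_+ zeta, and the last product is integrated by a
    Hoelder bound. *)
Lemma risk_le_dual eta : (risk (phi_power k) tau mu X <= (dual_objective eta)%:E)%E.
Proof.
apply: ge_ereal_sup => _ [zeta zadm <-].
have [izk zk] := admissible_powR zadm.
have [mz z0 z1 _] := zadm.
have [iz {}z1] := integrable_density mz z0 z1.
have iXz : mu.-integrable [set: T] (EFin \o (fun x => X x * zeta x)).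
  rewrite (_ : EFin \o _ = ((EFin \o X) \* (EFin \o zeta))%E); last first.
    by apply/funext => x; rewrite /= EFinM.
  apply: integrableMr => //.
  exists B; split; first exact: num_real.
  by move=> M' /ltW MM' x _; exact: le_trans (XB x) MM'.
have -> : (\int[mu]_x (X x * zeta x)%:E = (\int[mu]_x (X x * zeta x))%:E)%E.
  exact: EFin_Rintegral.
have iV := integrable_excess_powR mu1 mX XB eta (ltW p0).
rewrite lee_fin; apply/ler_addgt0Pr => e e0.
(* Young's inequality with any [v > V `^ p^-1] replaces Hoelder's. *)
pose v := V eta `^ p^-1 + e / c.
have V0 := excess_moment_ge0 mu X p eta.
have v0 : 0 < v by rewrite ltr_wpDl ?powR_ge0// divr_gt0.
have Vv : V eta <= v `^ p.
  have {1}-> : V eta = (V eta `^ p^-1) `^ p.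
    by rewrite -powRrM mulVf ?gt_eqF// powRr1.
  apply: ge0_ler_powR; rewrite ?nnegrE ?powR_ge0 ?(ltW p0) ?(ltW v0)//.
  by rewrite lerDl divr_ge0// ltW.
have vp0 : 0 < v `^ p by exact: powR_gt0.
have ck0 : 0 < c `^ k by exact: powR_gt0.
(* Young's inequality for the excess over [v] and [zeta] over [c], multiplied back by v c; the
   weights satisfy a v^p + b c^k = v c. *)
pose a := v * c / (p * v `^ p).
pose b := v * c / (k * c `^ k).
have a0 : 0 <= a by rewrite divr_ge0// mulr_ge0// ltW.
have b0 : 0 <= b by rewrite divr_ge0// mulr_ge0// ltW.
have young x : X x * zeta x <=
    eta * zeta x + (a * excess X eta x `^ p + b * zeta x `^ k).
  have Y0 := excess_ge0 X eta x.
  have : (excess X eta x / v) * (zeta x / c) <=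
      (excess X eta x / v) `^ p / p + (zeta x / c) `^ k / k.
    by apply: conjugate_powR => //; rewrite ?conj_expV// divr_ge0// ltW.
  rewrite !powR_div// => h.
  have h2 : X x * zeta x <= eta * zeta x + excess X eta x * zeta x.
    by rewrite -mulrDl ler_wpM2r// -lerBlDl excess_ge.
  apply: (le_trans h2); rewrite lerD2l.
  rewrite -(ler_pM2l (mulr_gt0 v0 c0)) in h.
  rewrite (_ : excess X eta x * zeta x =
    v * c * (excess X eta x / v * (zeta x / c))); last by field; rewrite !gt_eqF.
  apply: (le_trans h); rewrite le_eqVlt; apply/orP; left; apply/eqP.
  by rewrite /a /b; field; rewrite !gt_eqF.
have iaV := integrableZl measurableT a iV.
have ibz := integrableZl measurableT b izk.
have iez := integrableZl measurableT eta iz.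
have iab := integrableD measurableT iaV ibz.
have iall := integrableD measurableT iez iab.
apply: (@le_trans _ _ (\int[mu]_x (eta * zeta x +
    (a * excess X eta x `^ p + b * zeta x `^ k)))).
  exact: le_Rintegral.
rewrite RintegralD//.
rewrite RintegralD// !RintegralZl// z1 mulr1 -/(excess_moment mu X p eta).
rewrite /dual_objective -addrA lerD2l.
apply: (@le_trans _ _ (a * v `^ p + b * c `^ k)).
  by rewrite lerD// ler_wpM2l.
rewrite (_ : _ + _ = v * c * (p^-1 + k^-1)); last first.
  by rewrite /a /b; field; rewrite !gt_eqF.
rewrite conj_expV mulr1 /v mulrDl divfK ?gt_eqF// [c * _]mulrC.
exact: lexx.
Qed.


(** The density is (X - eta)_+^(p - 1) / N. Since (p - 1) k = p, its k-th moment is V / N^k, so the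
    hypothesis is exactly the divergence constraint. *)
Lemma excess_density_risk eta : 0 < N eta -> V eta <= (c * N eta) `^ k ->
  ((eta + V eta / N eta)%:E <= risk (phi_power k) tau mu X)%E.
Proof.
move=> N0 VN.
pose zeta x := (N eta)^-1 * excess X eta x `^ (p - 1).
have iN := integrable_excess_powR mu1 mX XB eta (ltW p10).
have iV := integrable_excess_powR mu1 mX XB eta (ltW p0).
have iz : mu.-integrable [set: T] (EFin \o zeta).
  exact: (integrableZl measurableT _ iN).
have z1 : \int[mu]_x zeta x = 1.
  by rewrite RintegralZl// -/(excess_moment mu X _ _) mulVf// gt_eqF.
have z0 x : 0 <= zeta x by rewrite mulr_ge0 ?invr_ge0 ?powR_ge0// ltW.
have zk x : zeta x `^ k = (N eta `^ k)^-1 * excess X eta x `^ p.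
  rewrite /zeta mulrC powR_div ?powR_ge0// -powRrM conj_expB1.
  by rewrite [RHS]mulrC.
have Xz x : X x * zeta x = eta * zeta x + (N eta)^-1 * excess X eta x `^ p.
  rewrite -(mulr_powRB1 (excess_ge0 X eta x) p0) /zeta.
  have [Y0|Y0] := leP (X x - eta) 0.
    by rewrite /excess (max_idPr Y0) powR0 ?gt_eqF// !(mulr0, mul0r) addr0.
  by rewrite [in X in _ + _ * (X * _)]/excess (max_idPl (ltW Y0)); ring.
apply: ereal_sup_ubound; exists zeta.
  split => //.
  - by apply/measurable_EFinP; case/integrableP : iz.
  - by rewrite EFin_Rintegral// z1.
  - under eq_integral do rewrite phi_powerE//.
    pose a := (N eta `^ k * (k * (k - 1)))^-1.
    have phiE x : (zeta x `^ k - k * zeta x + k - 1) / (k * (k - 1)) =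
        (a * excess X eta x `^ p + (- (k - 1)^-1) * zeta x) + k^-1.
      rewrite zk /a; field; rewrite !gt_eqF//; exact: powR_gt0.
    under eq_integral do rewrite phiE.
    have i1 := integrableZl measurableT a iV.
    have i2 := integrableZl measurableT (- (k - 1)^-1) iz.
    have i12 := integrableD measurableT i1 i2.
    have i3 := integrable_cst1 mu1 k^-1.
    have i123 := integrableD measurableT i12 i3.
    rewrite EFin_Rintegral// RintegralD// RintegralD//.
    rewrite [X in X + _ + _]RintegralZl// [X in _ + X + _]RintegralZl// z1.
    rewrite mulr1 -/(excess_moment mu X p eta) Rintegral_cst1// lee_fin.
    rewrite powRM ?(ltW N0) ?(ltW c0)// dual_radius_powR in VN.
    have Nk : 0 < N eta `^ k by exact: powR_gt0.
    rewrite mulrC -ler_pdivrMl// in VN.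
    have -> : a * V eta - (k - 1)^-1 + k^-1 =
        ((N eta `^ k)^-1 * V eta - 1) / (k * (k - 1)).
      by rewrite /a; field; rewrite !gt_eqF.
    rewrite ler_pdivrMr//; lra.
under eq_integral do rewrite Xz.
have i1 := integrableZl measurableT eta iz.
have i2 := integrableZl measurableT (N eta)^-1 iV.
have i12 := integrableD measurableT i1 i2.
rewrite EFin_Rintegral// RintegralD// [X in X + _]RintegralZl//.
rewrite [X in _ + X]RintegralZl// z1 mulr1.
by rewrite -/(excess_moment mu X p eta) [V eta / _]mulrC.
Qed.

(** The equation is the stationarity condition of the dual objective in [eta]. It makes the
    divergence constraint tight and gives c V^(1/p) = V / N. *)
Lemma dual_objective_le_risk eta : 0 < N eta -> V eta = (c * N eta) `^ k ->
  ((dual_objective eta)%:E <= risk (phi_power k) tau mu X)%E.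
Proof.
move=> N0 VN.
rewrite (_ : dual_objective eta = eta + V eta / N eta).
  by apply: excess_density_risk => //; rewrite VN.
congr (_ + _); rewrite VN -powRrM.
have cN : 0 < c * N eta by exact: mulr_gt0.
have -> : k * p^-1 = k - 1 by rewrite /p; field; rewrite !gt_eqF.
by rewrite -(mulr_powRB1 (ltW cN) k0); field; rewrite gt_eqF.
Qed.

Let sign_change_root (f : R -> R) (a b : R) : a <= b -> continuous f ->
  f a <= 0 -> 0 <= f b -> exists2 x, x <= b & f x = 0.
Proof.
move=> ab fc fa fb; have [||x] := @IVT _ f a b 0 ab.
- exact: continuous_subspaceT.
- by rewrite ge_min le_max fa fb orbT.
- by rewrite in_itv/= => /andP[_ xb] fx; exists x.
Qed.

(** Far to the left of - B', the two extreme values of the excess have a ratio close to 1, hence at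
    most [g]. *)
Let far_below (g B' e : R) : 0 <= B' -> 1 < g -> e * (g - 1) <= - (B' * (1 + g)) ->
  0 <= - B' - e /\ B' - e <= g * (- B' - e).
Proof.
move=> B0 g1 h; split; last by lra.
rewrite subr_ge0 -(ler_pM2r (_ : 0 < g - 1)) ?subr_gt0//; apply: (le_trans h).
by rewrite mulNr lerN2 ler_wpM2l//; lra.
Qed.

(* If [V = (c * N) `^ k] has a solution with [N > 0], it gives a primal
   optimum; otherwise every [eta] below the essential supremum of [X] is a lower
   bound of the risk, as witnessed by a density supported on [X > eta]. *)
Lemma strong_duality (r : R) : (forall eta, r <= dual_objective eta) ->
  (r%:E <= risk (phi_power k) tau mu X)%E.
Proof.
move=> hr; have [[eta1 [N1 V1]]|hA] :=
  pselect (exists eta, 0 < N eta /\ (c * N eta) `^ k <= V eta).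
  have B0 : 0 <= B by exact: le_trans (XB point).
  pose g := c `^ (k - 1).
  have g1 : 1 < g.
    rewrite -[ltLHS](powRr0 c) /g /powR gt_eqF// ltr_expR mul0r.
    by rewrite mulr_gt0// ln_gt0// dual_radius_gt1.
  (* So far left, the excess is nearly constant, and comparing its extreme values forces V <= (c
     N)^k, opposite to the inequality at [eta1]. The intermediate value theorem then yields
     equality. *)
  pose eta0 := Num.min eta1 (- (B * (1 + g) / (g - 1))).
  have e01 : eta0 <= eta1 by rewrite ge_min lexx.
  have e0 : eta0 * (g - 1) <= - (B * (1 + g)).
    by rewrite -ler_pdivlMr ?subr_gt0// mulNr ge_min lexx orbT.
  have [B0' ge1] := far_below B0 g1 e0.
  have B0'' : 0 <= B - eta0.
    by rewrite subr_ge0 (le_trans (y := - B)) ?ge0_cp// -subr_ge0.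
  pose G eta := V eta - (c * N eta) `^ k.
  have Gc : continuous G.
    have GE : G = fun eta => V eta - Num.max (c * N eta) 0 `^ k.
      apply/funext => eta; rewrite (max_idPl _)//.
      by rewrite mulr_ge0 ?excess_moment_ge0// ltW.
    rewrite GE => eta; apply: cvgB.
      exact: (continuous_excess_moment mu1 mX XB p0).
    apply: (@continuous_comp _ _ _ (fun e => c * N e) (fun y => Num.max y 0 `^ k)).
      apply: cvgM; first exact: cvg_cst.
      exact: (continuous_excess_moment mu1 mX XB p10).
    exact: continuous_pos_part_powR.
  have G0 : G eta0 <= 0.
    rewrite subr_le0.
    have h1 : V eta0 <= (B - eta0) `^ p.
      apply: (excess_moment_le mu1 mX XB (eta := eta0) (ltW p0) B0'').
      move=> x; apply: (le_trans (excess_le_norm XB eta0 x)).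
      by rewrite ler0_norm// (le_trans (y := - B)) ?oppr_le0// -subr_ge0.
    have h2 : (- B - eta0) `^ (p - 1) <= N eta0.
      apply: (excess_moment_ge mu1 mX XB (eta := eta0) (ltW p10) B0').
      move=> x; apply: le_trans (excess_ge _ _ _); rewrite lerD2r.
      by have := XB x; rewrite ler_norml => /andP[].
    apply: (le_trans h1).
    apply: (@le_trans _ _ ((g * (- B - eta0)) `^ p)).
      apply: ge0_ler_powR; rewrite ?nnegrE ?(ltW p0)//.
      exact: le_trans ge1.
    rewrite powRM ?powR_ge0//.
    rewrite -powRrM (_ : (k - 1) * p = k); last first.
      by rewrite /p; field; rewrite gt_eqF.
    rewrite powRM ?(ltW c0) ?excess_moment_ge0// ler_wpM2l ?powR_ge0//.
    rewrite (_ : (- B - eta0) `^ p = ((- B - eta0) `^ (p - 1)) `^ k); last first.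
      by rewrite -powRrM conj_expB1.
    apply: (ge0_ler_powR (ltW k0) _ _ h2); rewrite nnegrE.
      exact: powR_ge0.
    exact: excess_moment_ge0.
  have G1 : 0 <= G eta1 by rewrite subr_ge0.
  have [eta ee1 /eqP] := sign_change_root e01 Gc G0 G1.
  rewrite subr_eq0 => /eqP VN.
  apply: (le_trans (y := (dual_objective eta)%:E)); first by rewrite lee_fin.
  (* The root lies left of [eta1], and [N] is nonincreasing. *)
  have N0 : 0 < N eta.
    exact: lt_le_trans N1 (excess_moment_anti mu1 mX XB (ltW p10) ee1).
  exact: (dual_objective_le_risk N0 VN).
apply/lee_addgt0Pr => e e0.
have := excess_moment_ge0 mu X (p - 1) (r - e).
(* If [N] vanishes at r - e, so does [V], and the dual objective there is r - e, below its lower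
   bound [r]. Otherwise the explicit density at r - e has expectation at least r - e. *)
rewrite le_eqVlt => /predU1P[/esym N0|N0].
  exfalso; have := hr (r - e); apply/negP; rewrite -ltNge /dual_objective.
  rewrite (excess_moment_eq0 mu1 mX XB conj_exp_gt1 N0).
  by rewrite powR0 ?invr_eq0 ?gt_eqF// mulr0 addr0 ltrBlDr ltrDl.
rewrite -leeBlDr//; apply: le_trans (excess_density_risk N0 _).
  by rewrite -EFinB lee_fin lerDl divr_ge0 ?excess_moment_ge0.
have [//|/ltW VN] := leP (V (r - e)) ((c * N (r - e)) `^ k).
by exfalso; apply: hA; exists (r - e).
Qed.

End fixed_measure.
End dual.

(** * Localization and Lipschitz continuity of the dual objective *)

Section dual_bounds.
Context (R : realType) (k tau : R) d (T : measurableType d).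
Variables (mu : {measure set T -> \bar R}) (X : T -> R) (B : R).
Hypotheses (k1 : 1 < k) (tau0 : 0 < tau).
Hypothesis mu1 : mu [set: T] = 1%E.
Hypothesis mX : measurable_fun [set: T] X.
Hypothesis XB : forall x, `|X x| <= B.

Local Notation p := (conj_exp k).
Local Notation c := (dual_radius k tau).
Local Notation V := (excess_moment mu X p).
Local Notation obj := (dual_objective k tau mu X).

Let p1 : 1 < p. Proof. exact: conj_exp_gt1. Qed.
Let p0 : 0 < p. Proof. exact: lt_trans p1. Qed.
Let c1 : 1 < c. Proof. exact: dual_radius_gt1. Qed.
Let c0 : 0 < c. Proof. exact: lt_trans c1. Qed.

Lemma dual_objective_ge eta : eta <= obj eta.
Proof. by rewrite lerDl mulr_ge0 ?powR_ge0// ltW. Qed.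

Lemma excess_norm_ge eta : eta <= - B -> - B - eta <= V eta `^ p^-1.
Proof.
move=> eB; have a0 : 0 <= - B - eta by rewrite subr_ge0.
have h : (- B - eta) `^ p <= V eta.
  apply: (excess_moment_ge mu1 mX XB (eta := eta) (ltW p0) a0) => x.
  apply: le_trans (excess_ge _ _ _); rewrite lerD2r.
  by have := XB x; rewrite ler_norml => /andP[].
have -> : - B - eta = ((- B - eta) `^ p) `^ p^-1.
  by rewrite -powRrM mulfV ?gt_eqF// powRr1.
apply: (ge0_ler_powR _ _ _ h); rewrite ?nnegrE ?powR_ge0 ?excess_moment_ge0//.
by rewrite invr_ge0 ltW.
Qed.

(** The objective is at least eta + c (- B - eta), which decreases in [eta] as c > 1 and equals [B]
    at the threshold. As the risk is at most [B], only a bounded interval of [eta] matters. *)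
Lemma dual_objective_ge_bound eta : eta <= - ((1 + c) / (c - 1) * B) ->
  B <= obj eta.
Proof.
move=> eB; have c10 : 0 < c - 1 by rewrite subr_gt0.
have B0 : 0 <= B by exact: le_trans (XB point).
have h : B * (1 + c) <= - eta * (c - 1).
  rewrite (_ : B * (1 + c) = (1 + c) / (c - 1) * B * (c - 1)).
    by rewrite ler_pM2r// lerNr.
  by field; rewrite gt_eqF.
have eB' : eta <= - B.
  rewrite lerNr -(ler_pM2r c10); apply: le_trans h.
  by rewrite ler_wpM2l//; lra.
have := excess_norm_ge eB'; rewrite -(ler_pM2l c0) => h2.
rewrite /dual_objective; apply: (@le_trans _ _ (eta + c * (- B - eta))); last first.
  by rewrite lerD2l.
lra.
Qed.

(** Weak duality at eta = B, where the excess vanishes. *)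
Lemma risk_le_bound : (risk (phi_power k) tau mu X <= B%:E)%E.
Proof.
apply: (le_trans (risk_le_dual k1 tau0 mu1 mX XB B)).
rewrite lee_fin /dual_objective (_ : V B = 0).
  by rewrite powR0 ?invr_eq0 ?gt_eqF// mulr0 addr0.
apply/eqP; rewrite eq_le excess_moment_ge0 andbT.
rewrite -[leRHS](powR0 (lt0r_neq0 p0)).
apply: (excess_moment_le mu1 mX XB (eta := B) (ltW p0)) => // x.
by rewrite -[leRHS](subrr B) excess_le.
Qed.

Lemma risk_ge_bound : ((- B)%:E <= risk (phi_power k) tau mu X)%E.
Proof.
apply: (strong_duality k1 tau0 mu1 mX XB) => eta.
have [eB|/ltW eB] := leP (- B) eta; first exact: le_trans (dual_objective_ge _).
have h := excess_norm_ge eB.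
rewrite -lerBlDl; apply: (le_trans h); rewrite ler_peMl ?powR_ge0//; exact: ltW.
Qed.

(** From (X - eta + h)_+ <= (X - eta)_+ + h. Working with the norm rather than with [V] gives a
    Lipschitz constant that stays bounded where [V] is near 0. *)
Lemma excess_norm_minkowski eta h : 0 <= h ->
  V (eta - h) `^ p^-1 <= V eta `^ p^-1 + h.
Proof.
move=> h0.
have LE (f : T -> R) : Lnorm mu p%:E (EFin \o f) =
    ((\int[mu]_x (`|f x| `^ p)%:E)%E `^ p^-1)%E.
  by rewrite unlock.
have NV e : Lnorm mu p%:E (EFin \o excess X e) = (V e `^ p^-1)%:E.
  rewrite LE -poweR_EFin -(excess_momentE mu1 mX XB e (ltW p0)).
  by congr (_ `^ _)%E; apply: eq_integral => x _; rewrite ger0_norm ?excess_ge0.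
have Nh : Lnorm mu p%:E (EFin \o (fun=> h)) = h%:E.
  rewrite LE integral_cst1// poweR_EFin -powRrM mulfV ?gt_eqF//.
  by rewrite powRr1 ger0_norm.
have := @minkowski_EFin _ _ _ mu (excess X eta) (fun=> h) p
  (measurable_excess mX eta) (measurable_cst _) (ltW p1).
rewrite NV Nh -EFinD => mk.
rewrite -lee_fin; apply: le_trans mk.
rewrite -NV !LE; apply: gt0_ler_poweR; rewrite ?invr_ge0 ?(ltW p0)//.
- by rewrite in_itv/= leey andbT integral_ge0// => x _; rewrite lee_fin powR_ge0.
- by rewrite in_itv/= leey andbT integral_ge0// => x _; rewrite lee_fin powR_ge0.
apply: le_integral_ge0 => x; first by rewrite lee_fin powR_ge0.
rewrite lee_fin; apply: ge0_ler_powR; rewrite ?nnegrE ?(ltW p0)//.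
have e0 := excess_ge0 X eta x.
rewrite !ger0_norm ?excess_ge0 ?addr_ge0//.
rewrite ge_max addr_ge0// andbT.
have -> : X x - (eta - h) = X x - eta + h by ring.
by rewrite lerD2r excess_ge.
Qed.

Lemma dual_objective_step eta eta' h : eta' <= eta -> eta <= eta' + h ->
  obj eta' <= obj eta + c * h.
Proof.
move=> ee eh; have h0 : 0 <= h by lra.
rewrite /dual_objective -addrA lerD// -mulrDr ler_wpM2l ?(ltW c0)//.
apply: le_trans (excess_norm_minkowski eta h0).
have hV : V eta' <= V (eta - h).
  by apply: (excess_moment_anti mu1 mX XB (ltW p0)); rewrite lerBlDr.
apply: (ge0_ler_powR _ _ _ hV).
- by rewrite invr_ge0 ltW.
- by rewrite nnegrE; exact: excess_moment_ge0.
- by rewrite nnegrE; exact: excess_moment_ge0.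
Qed.

End dual_bounds.

(** * Discretization of the dual variable *)

Section risk_comparison.
Context (R : realType) (k tau : R) d (T : measurableType d).
Variables (mu nu : {measure set T -> \bar R}) (X : T -> R) (B : R).
Hypotheses (k1 : 1 < k) (tau0 : 0 < tau).
Hypotheses (mu1 : mu [set: T] = 1%E) (nu1 : nu [set: T] = 1%E).
Hypothesis mX : measurable_fun [set: T] X.
Hypothesis XB : forall x, `|X x| <= B.
Hypothesis B0 : 0 < B.

Local Notation c := (dual_radius k tau).

(** Length of the interval ending at [B] outside of which the dual objective is at least [B]. *)
Definition dual_width : R := (1 + c) / (c - 1) * B + B.
Definition dual_grid (M : nat) (j : nat) : R :=
  - ((1 + c) / (c - 1) * B) + j%:R * (dual_width / M%:R).

(** Strong duality for [nu] and weak duality for [mu]: each [eta] is rounded down to the grid, where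
    the two objectives are compared. *)
Lemma risk_le_add (M : nat) (e e1 : R) : (0 < M)%N ->
  (forall j : 'I_M.+1, dual_objective k tau mu X (dual_grid M j) <=
    dual_objective k tau nu X (dual_grid M j) + e1) ->
  0 <= e -> e1 + c * (dual_width / M%:R) <= e ->
  (risk (phi_power k) tau mu X <= risk (phi_power k) tau nu X + e%:E)%E.
Proof.
move=> M0 He e0 hle.
have rB := risk_le_bound k1 tau0 mu1 mX XB.
have rD := risk_le_dual k1 tau0 mu1 mX XB.
have rb := risk_ge_bound k1 tau0 mu1 mX XB.
case: (risk _ _ mu X) rB rD rb => [r| |]//; rewrite !lee_fin => rB rD rb.
rewrite -leeBlDr// -EFinB; apply: (strong_duality k1 tau0 nu1 mX XB) => eta.
have re : r - e <= B by rewrite (le_trans _ rB)// gerBl.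
have [/ltW eB|eB] := ltP B eta.
  by apply: (le_trans re); apply: (le_trans eB); exact: dual_objective_ge.
have [/ltW eT|eT] := ltP eta (- ((1 + c) / (c - 1) * B)).
  by apply: (le_trans re); exact: (dual_objective_ge_bound k1 tau0 nu1 mX XB).
have c1 : 1 < c by exact: dual_radius_gt1.
have W0 : 0 < dual_width.
  by rewrite addr_gt0// mulr_gt0// divr_gt0// ?subr_gt0// addr_gt0// (lt_trans _ c1).
set h := dual_width / M%:R in hle.
have h0 : 0 < h by rewrite divr_gt0// ltr0n.
(* Position of [eta] in grid steps; its integer part indexes the grid point just below. The endpoint
   eta = B has index [M], whence M + 1 points. *)
pose t := (eta + (1 + c) / (c - 1) * B) / h.
have t0 : 0 <= t by rewrite divr_ge0 ?(ltW h0)// -lerBlDr sub0r.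
have tM : t <= M%:R.
  rewrite ler_pdivrMr// /h [M%:R * _]mulrC divfK ?pnatr_eq0 -?lt0n//.
  by rewrite addrC lerD2l.
have jM : (Num.truncn t < M.+1)%N.
  by rewrite truncn_lt_nat// (le_lt_trans tM)// ltr_nat.
have /andP[t1 t2] := truncn_itv t0.
have tE : t * h = eta + (1 + c) / (c - 1) * B by rewrite divfK// gt_eqF.
rewrite -(ler_pM2r h0) tE in t1; rewrite -(ltr_pM2r h0) tE in t2.
rewrite -natr1 mulrDl mul1r in t2.
have Hj := He (Ordinal jM); have rj := rD (dual_grid M (Num.truncn t)).
rewrite lee_fin in rj; rewrite /= in Hj.
have step : dual_objective k tau nu X (dual_grid M (Num.truncn t)) <=
    dual_objective k tau nu X eta + c * h.
  apply: (dual_objective_step k1 tau0 nu1 mX XB); rewrite /dual_grid -/h; lra.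
rewrite lerBlDr; apply: (le_trans rj); apply: (le_trans Hj).
apply: (@le_trans _ _ (dual_objective k tau nu X eta + c * h + e1)).
  by rewrite lerD2r.
by rewrite -addrA lerD2l addrC.
Qed.

End risk_comparison.

Lemma integral_empirical d (T : measurableType d) (R : realType) n
    (w : n.-tuple T) (f : T -> R) :
  measurable_fun [set: T] f -> (forall x, 0 <= f x) ->
  (\int[empirical R w]_x (f x)%:E = (sample_mean f w)%:E)%E.
Proof.
move=> mf f0; have mEf : measurable_fun [set: T] (EFin \o f).
  exact/measurable_EFinP.
rewrite /empirical ge0_integral_mscale//; last first.
  by move=> x _; rewrite lee_fin.
rewrite ge0_integral_measure_sum//; last by move=> x _; rewrite lee_fin.
rewrite /sample_mean EFinM -sumEFin; congr (_ * _)%E.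
apply: eq_bigr => i _; rewrite integral_dirac// diracT mul1e.
by rewrite (tnth_nth point).
Qed.

(** * Concentration of the empirical risk *)

Section concentration.
Context (R : realType) (k tau : R) d (T : measurableType d).
Variables (P : probability T R) (X : T -> R) (B eps : R) (n : nat).
Hypotheses (k1 : 1 < k) (tau0 : 0 < tau) (B0 : 0 < B) (n0 : (0 < n)%N).
Hypothesis mX : measurable_fun [set: T] X.
Hypothesis XB : forall x, `|X x| <= B.
Hypothesis eps0 : 0 < eps <= B.

Local Notation p := (conj_exp k).
Local Notation q := (Num.max 2 (conj_exp k)).
Local Notation c := (dual_radius k tau).
Local Notation D := (dual_width k tau B).

Let p1 : 1 < p. Proof. exact: conj_exp_gt1. Qed.
Let p0 : 0 < p. Proof. exact: lt_trans p1. Qed.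
Let c1 : 1 < c. Proof. exact: dual_radius_gt1. Qed.
Let c0 : 0 < c. Proof. exact: lt_trans c1. Qed.
Let q0 : 0 < q. Proof. by rewrite lt_max ltr0n. Qed.
Let P1 : (P : {measure set T -> \bar R}) [set: T] = 1%E.
Proof. exact: probability_setT. Qed.

Let BD : B <= D.
Proof.
rewrite /dual_width lerDr mulr_ge0 ?(ltW B0)// divr_ge0//.
- by rewrite addr_ge0// ltW.
- by rewrite subr_ge0 ltW.
Qed.
Let D0 : 0 < D. Proof. exact: lt_le_trans BD. Qed.

(** The Chernoff parameter [s]. The factor 16 makes 4 c D s^(1/q) equal to eps / 4, the error
    allowed at each grid point. *)
Definition sample_rate : R := (eps / (16 * c * D)) `^ q.

Lemma sample_rate_itv : 0 < sample_rate <= 1.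
Proof.
have /andP[e0 eB] := eps0.
have cD : 0 < 16 * c * D by rewrite !mulr_gt0.
rewrite powR_gt0 ?divr_gt0//=.
rewrite -[leRHS](_ : 1 `^ q = 1); last by rewrite powR1.
apply: ge0_ler_powR; rewrite ?nnegrE ?(ltW q0) ?divr_ge0 ?(ltW e0) ?(ltW cD)//.
rewrite ler_pdivrMr// mul1r (le_trans eB)// (le_trans BD)// ler_peMl ?(ltW D0)//.
by have := c1; lra.
Qed.

Definition scaled_excess (eta : R) (x : T) : R := excess X eta x `^ p / D `^ p.

Let Dp0 : 0 < D `^ p. Proof. exact: powR_gt0. Qed.

Lemma measurable_scaled_excess eta : measurable_fun [set: T] (scaled_excess eta).
Proof. by apply: measurable_funM => //; exact: measurable_excess_powR. Qed.

Lemma scaled_excess_itv eta x : excess X eta x <= D -> 0 <= scaled_excess eta x <= 1.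
Proof.
move=> eD; rewrite divr_ge0 ?powR_ge0//= ler_pdivrMr// mul1r.
by apply: (ge0_ler_powR (ltW p0) _ _ eD); rewrite nnegrE ?excess_ge0// ltW.
Qed.

(** Under both measures the moment is D^p times the mean of [scaled_excess], so [distr_root_le]
    compares the two p-norms. *)
Lemma dual_objective_close (w : n.-tuple T) (eta m : R) :
  (forall x, excess X eta x <= D) ->
  (\int[P]_x (scaled_excess eta x)%:E = m%:E)%E ->
  `|sample_mean (scaled_excess eta) w - m|
    <= 3 * Num.sqrt (sample_rate * Num.max m sample_rate) ->
  `|dual_objective k tau P X eta - dual_objective k tau (empirical R w) X eta|
    <= eps / 4.
Proof.
move=> eD mE hdev.
have ms := measurable_scaled_excess eta.
have s01 x : 0 <= scaled_excess eta x <= 1 by exact: scaled_excess_itv.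
have m01 := mean_itv01 s01 mE.
have a0 : 0 <= sample_mean (scaled_excess eta) w.
  rewrite mulr_ge0 ?invr_ge0// sumr_ge0// => i _.
  by case/andP: (s01 (tnth w i)).
set a := sample_mean _ w in hdev a0 *.
have VP : excess_moment P X p eta = D `^ p * m.
  apply: EFin_inj; rewrite -(excess_momentE P1 mX XB eta (ltW p0)) EFinM -mE.
  rewrite -ge0_integralZl_EFin//; last 3 first.
  - by move=> x _; rewrite lee_fin; case/andP: (s01 x).
  - exact/measurable_EFinP.
  - exact: ltW.
  by apply: eq_integral => x _; rewrite -EFinM mulrC divfK ?gt_eqF.
have Vw : excess_moment (empirical R w) X p eta = D `^ p * a.
  have w1 := empirical_setT R w n0.
  apply: EFin_inj; rewrite -(excess_momentE w1 mX XB eta (ltW p0)).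
  rewrite EFinM -integral_empirical//; last by move=> x; case/andP: (s01 x).
  rewrite -ge0_integralZl_EFin//; last 3 first.
  - by move=> x _; rewrite lee_fin; case/andP: (s01 x).
  - exact/measurable_EFinP.
  - exact: ltW.
  by apply: eq_integral => x _; rewrite -EFinM mulrC divfK ?gt_eqF.
have hroot := distr_root_le (ltW p1) sample_rate_itv m01 a0 hdev.
have rootE y : 0 <= y -> (D `^ p * y) `^ p^-1 = D * y `^ p^-1.
  move=> y0; rewrite powRM ?powR_ge0// -powRrM mulfV ?gt_eqF//.
  by rewrite powRr1// ltW.
rewrite /dual_objective VP Vw !rootE//; last by case/andP: m01.
rewrite (_ : _ - _ = c * D * (m `^ p^-1 - a `^ p^-1)); last by ring.
have cD : 0 < c * D by exact: mulr_gt0.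
rewrite normrM (gtr0_norm cD) distrC.
apply: (@le_trans _ _ (c * D * (4 * sample_rate `^ q^-1))).
  by rewrite ler_pM2l.
rewrite /sample_rate -powRrM mulfV ?gt_eqF// powRr1; last first.
  have /andP[e0 _] := eps0.
  by rewrite divr_ge0 ?(ltW e0)// -mulrA mulr_ge0// ltW.
by rewrite le_eqVlt; apply/orP; left; apply/eqP; field; rewrite !gt_eqF.
Qed.

(** With the stated probability all objectives on the grid agree up to eps / 4; rounding to the grid
    adds at most eps / 2, and the comparison is made in both directions. *)
Lemma risk_concentration (M : nat) : (0 < M)%N -> c * (D / M%:R) <= eps / 2 ->
  ((1 - M.+1%:R * (2 * expR (- (n%:R * sample_rate))))%:E <=
    power_prob P n
      [set w | `|risk (phi_power k) tau P X
                 - risk (phi_power k) tau (empirical R w) X| <= eps%:E])%E.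
Proof.
move=> M0 hM; have /andP[s0 s1] := sample_rate_itv.
have /andP[e0 eB] := eps0.
pose Z (j : 'I_M.+1) := scaled_excess (dual_grid k tau B M j).
(* The leftmost grid point is B - D. *)
have eD (j : 'I_M.+1) x : excess X (dual_grid k tau B M j) x <= D.
  have hj : 0 <= j%:R * (D / M%:R) :> R by rewrite mulr_ge0// divr_ge0// ltW.
  have [jB|jB] := leP (dual_grid k tau B M j) B.
    apply: (le_trans (excess_le XB x jB)).
    by rewrite /dual_grid /dual_width in hj *; lra.
  rewrite ge_max (ltW D0) andbT.
  have := XB x; rewrite ler_norml => /andP[_ h].
  by rewrite (le_trans _ (ltW D0))// subr_le0 (le_trans h)// ltW.
have mZ j : measurable_fun [set: T] (Z j) by exact: measurable_scaled_excess.
have Z01 j x : 0 <= Z j x <= 1 by apply: scaled_excess_itv; exact: eD.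
have iZ j : (\int[P]_x (Z j x)%:E = (\int[P]_x Z j x)%:E)%E.
  apply: EFin_Rintegral; apply: (bounded_integrable (M := 1)) => // x.
  by have /andP[h1 h2] := Z01 j x; rewrite ger0_norm.
apply: (le_trans (sample_means_uniform n0 s0 mZ Z01 iZ)).
apply: le_power_prob => w /= hw.
have w1 := empirical_setT R w n0.
have close j := dual_objective_close (eD j) (iZ j) (hw j).
have le1 : (risk (phi_power k) tau P X
    <= risk (phi_power k) tau (empirical R w) X + eps%:E)%E.
  apply: (risk_le_add (e1 := eps / 4) k1 tau0 P1 w1 mX XB B0 M0 _ (ltW e0)).
    by move=> j; have := close j; rewrite ler_norml => /andP[_]; lra.
  lra.
have le2 : (risk (phi_power k) tau (empirical R w) X
    <= risk (phi_power k) tau P X + eps%:E)%E.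
  apply: (risk_le_add (e1 := eps / 4) k1 tau0 w1 P1 mX XB B0 M0 _ (ltW e0)).
    by move=> j; have := close j; rewrite ler_norml => /andP[+ _]; lra.
  lra.
have := risk_le_bound k1 tau0 P1 mX XB; have := risk_ge_bound k1 tau0 P1 mX XB.
have := risk_le_bound k1 tau0 w1 mX XB; have := risk_ge_bound k1 tau0 w1 mX XB.
case: (risk _ _ P X) le1 le2 => [r| |]//.
case: (risk _ _ (empirical R w) X) => [r'| |]//.
rewrite -!EFinD !lee_fin => h1 h2 _ _ _ _.
by rewrite ler_norml; apply/andP; split; lra.
Qed.

End concentration.

(** * Number of samples *)

Section sample_complexity.
Context (R : realType).

Definition log_factor (B eps delta : R) : R :=
  ln (expR 1 + B + B^-1 + eps^-1 + delta^-1).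

Variables (B eps delta : R).
Hypotheses (B0 : 0 < B) (eps0 : 0 < eps) (delta0 : 0 < delta).

Local Notation L := (log_factor B eps delta).

Lemma log_factor_ge1 : 1 <= L.
Proof.
have e1 := expR_gt0 (1 : R).
rewrite -[leLHS](expRK (1 : R)) /log_factor -!addrA ler_ln ?posrE//.
  by rewrite lerDl !addr_ge0 ?invr_ge0 ?ltW.
by rewrite !addr_gt0 ?invr_gt0.
Qed.

(** The logarithm splits into four terms: those of B, 1/eps and 1/delta are each at most L, and ln A
    <= L ln A since L >= 1. *)
Lemma ln_sample_bound A : 1 <= A -> ln (A * (B / eps) / delta) <= (ln A + 3) * L.
Proof.
move=> A1; have A0 : 0 < A by lra.
have hL x : 0 < x -> x <= expR 1 + B + B^-1 + eps^-1 + delta^-1 -> ln x <= L.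
  by move=> x0 hx; rewrite /log_factor ler_ln ?posrE// (lt_le_trans x0).
have sum_ge (x1 x2 x3 x4 x5 : R) : 0 < x1 -> 0 < x2 -> 0 < x3 -> 0 < x4 ->
    0 < x5 -> [/\ x2 <= x1 + x2 + x3 + x4 + x5, x4 <= x1 + x2 + x3 + x4 + x5 &
      x5 <= x1 + x2 + x3 + x4 + x5].
  by move=> *; split; lra.
have [|||s1 s2 s3] := @sum_ge (expR 1) B B^-1 eps^-1 delta^-1 (expR_gt0 _) B0;
  rewrite ?invr_gt0//.
rewrite !lnM ?posrE ?mulr_gt0 ?invr_gt0//.
have h1 : ln B <= L by exact: hL.
have h2 : ln eps^-1 <= L by apply: hL; rewrite ?invr_gt0.
have h3 : ln delta^-1 <= L by apply: hL; rewrite ?invr_gt0.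
have h4 : ln A <= ln A * L by rewrite ler_peMr ?log_factor_ge1// ln_ge0.
lra.
Qed.

End sample_complexity.

(** With a grid of order B / eps points, the failure probability is at most [delta] once n s >= ln(A
    (B / eps) / delta). *)
Theorem risk_sample_complexity (R : realType) (k tau : R) :
  1 < k -> 0 < tau ->
  exists C : R, 0 < C /\
  forall (B : R), 0 < B ->
  forall (d : measure_display) (T : measurableType d)
    (P : probability T R) (X : T -> R),
  measurable_fun [set: T] X -> (forall x, X x \in `[- B, B]) ->
  forall delta : R, 0 < delta < 1 ->
  forall eps : R, 0 < eps <= B ->
  forall n : nat,
  C * log_factor B eps delta `^ C * (B / eps) `^ Num.max 2 (conj_exp k) <= n%:R ->
  ((1 - delta)%:E <=
    power_prob P n
      [set w | `|risk (phi_power k) tau P X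
                 - risk (phi_power k) tau (empirical R w) X| <= eps%:E])%E.
Proof.
move=> k1 tau0.
pose c := dual_radius k tau; pose q := Num.max 2 (conj_exp k).
have c1 : 1 < c by exact: dual_radius_gt1.
(* [kappa] is the ratio of [dual_width] to [B]; [A] satisfies 2 (M + 1) <= A B / eps; and [K] gives
   1 / s = K (B / eps)^q. *)
pose kappa : R := (1 + c) / (c - 1) + 1.
pose A := 2 * (2 * c * kappa + 2).
pose K := (16 * c * kappa) `^ q.
have kappa0 : 0 < kappa by rewrite addr_gt0// divr_gt0//; lra.
have ck0 : 0 < c * kappa by rewrite mulr_gt0//; lra.
have A1 : 1 <= A by rewrite /A -[2 * c * _]mulrA; lra.
have lA : 0 <= ln A by exact: ln_ge0.
have K0 : 0 < K by rewrite powR_gt0// -mulrA; lra.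
(* The argument gives a bound linear in L; as L and C are at least 1, L <= L^C and one constant
   serves as factor and exponent. *)
exists (1 + K * (ln A + 3)); set C := 1 + _.
have C1 : 1 <= C by rewrite /C lerDl mulr_ge0 ?(ltW K0)//; lra.
split; first by lra.
move=> B B0 d T P X mX XB delta /andP[d0 d1] eps /andP[e0 eB] n hn.
have XB' x : `|X x| <= B.
  by have := XB x; rewrite in_itv/= ler_norml.
have Be1 : 1 <= B / eps by rewrite ler_pdivlMr// mul1r.
have Be0 : 0 < B / eps by lra.
have L1 := log_factor_ge1 B0 e0 d0.
set L := log_factor B eps delta in hn L1.
have LC : L <= L `^ C by exact: le1r_powR.
have Bq0 : 0 < (B / eps) `^ q by exact: powR_gt0.
have n0 : (0 < n)%N.
  rewrite -(ltr0n R); apply: lt_le_trans hn.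
  by rewrite !mulr_gt0//; [lra|rewrite powR_gt0; lra].
have WE : dual_width k tau B = kappa * B by rewrite /dual_width /kappa /c; ring.
(* Large enough that rounding to the grid costs at most eps / 2. *)
pose M := (Num.truncn (2 * c * kappa * (B / eps))).+1.
have x0 : 0 <= 2 * c * kappa * (B / eps).
  by rewrite mulr_ge0 ?(ltW Be0)// -mulrA; lra.
have /andP[M1 M2] := truncn_itv x0.
have M0 : 0 < M%:R :> R by rewrite ltr0n.
have e0B : 0 < eps <= B by rewrite e0.
have hM : c * (dual_width k tau B / M%:R) <= eps / 2.
  rewrite WE mulrA ler_pdivrMr//.
  have : eps / 2 * (2 * c * kappa * (B / eps)) <= eps / 2 * M%:R.
    by rewrite ler_pM2l ?divr_gt0//; exact: ltW.
  have -> // : eps / 2 * (2 * c * kappa * (B / eps)) = c * (kappa * B).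
  by field; rewrite gt_eqF.
have M0' : (0 < M)%N by [].
apply: (le_trans _ (risk_concentration P k1 tau0 B0 n0 mX XB' e0B M0' hM)).
rewrite lee_fin lerD2l lerN2.
have MA : M.+1%:R * 2 <= A * (B / eps).
  rewrite -natr1 /M -natr1.
  have -> : A * (B / eps) = 2 * (2 * c * kappa * (B / eps)) + 4 * (B / eps).
    by rewrite /A; ring.
  lra.
have nrate : ln (A * (B / eps) / delta) <= n%:R * sample_rate k tau B eps.
  apply: (le_trans (ln_sample_bound B0 e0 d0 A1)); rewrite -/L.
  have -> : sample_rate k tau B eps = (K * (B / eps) `^ q)^-1.
    rewrite /sample_rate -/c -/q WE.
    have x1 : 0 < 16 * c * kappa * (B / eps) by rewrite mulr_gt0// -mulrA; lra.
    have -> : eps / (16 * c * (kappa * B)) = 1 / (16 * c * kappa * (B / eps)).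
      by field; rewrite !gt_eqF//; lra.
    rewrite (powR_div q ler01 x1) powR1 div1r /K powRM// ?(ltW Be0)//.
    by rewrite -mulrA; lra.
  rewrite -ler_pdivrMr ?invr_gt0 ?mulr_gt0// invrK; apply: le_trans hn.
  rewrite mulrA ler_pM2r//.
  apply: (@le_trans _ _ (C * L)); last by rewrite ler_pM2l//; lra.
  by rewrite mulrAC ler_pM2r ?(lt_le_trans _ L1)// mulrC /C; lra.
have z0 : 0 < A * (B / eps) / delta by rewrite divr_gt0// mulr_gt0//; lra.
have hexp : expR (- (n%:R * sample_rate k tau B eps)) <= (A * (B / eps) / delta)^-1.
  have -> : (A * (B / eps) / delta)^-1 = expR (- ln (A * (B / eps) / delta)).
    by rewrite expRN lnK ?posrE.
  by rewrite ler_expR lerN2.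
rewrite mulrA; apply: (le_trans (ler_pM _ (expR_ge0 _) MA hexp)).
  by rewrite mulr_ge0.
rewrite invf_div mulrC divfK// gt_eqF// mulr_gt0//; lra.
Qed.

(** * Impossibility of estimation for [k < 1] *)

Section lower_bound.
Context (R : realType) (k tau : R).
Hypotheses (k_neq0 : k != 0) (k_lt1 : k < 1) (tau0 : 0 < tau).

(* As [p] tends to [0], moving mass [a] onto an event of probability [p] has
   divergence cost tending to [((1 - a) `^ k - 1) / (k * (k - 1))]. *)
Lemma cheap_mass_transfer : exists a p0 : R, [/\ 0 < a < 1, 0 < p0 &
  forall p, 0 < p -> p <= p0 -> p <= a /\
    (p `^ (1 - k) * a `^ k + (1 - p) `^ (1 - k) * (1 - a) `^ k - 1)
      / (k * (k - 1)) <= tau].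
Proof.
have k1 := k_lt1; have [k0|k0|k0] := ltgtP k 0; last by move: k_neq0; rewrite k0 eqxx.
- have kk : 0 < k * (k - 1) by rewrite nmulr_rgt0// subr_lt0.
  (* The budget 2 g is halved: b = 1 - a solves b^k = 1 + g, and p (a / p)^k <= p <= g because k < 0
     and p <= a. *)
  pose g := k * (k - 1) * tau / 2.
  have g0 : 0 < g by rewrite divr_gt0// mulr_gt0.
  pose b := (1 + g) `^ k^-1.
  have b0 : 0 < b by rewrite powR_gt0//; lra.
  have b1 : b < 1.
    rewrite -expR0 /b /powR gt_eqF; last by lra.
    by rewrite ltr_expR nmulr_rlt0 ?invr_lt0// ln_gt0//; lra.
  exists (1 - b), (Num.min (1 - b) g); split.
  + by apply/andP; split; lra.
  + by rewrite lt_min g0 andbT; lra.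
  move=> p p0; rewrite le_min => /andP[pa pg]; split=> //.
  have a0 : 0 < 1 - b by lra.
  rewrite ler_pdivrMr// subKr.
  have bk : b `^ k = 1 + g.
    by rewrite /b -powRrM mulVf// powRr1//; lra.
  have h1 : p `^ (1 - k) * (1 - b) `^ k <= p.
    rewrite powRB; last by rewrite (gt_eqF p0) implybT.
    rewrite powRr1 ?(ltW p0)// -mulrA ler_piMr ?(ltW p0)// mulrC.
    rewrite -powR_div// ?(ltW a0)//.
    rewrite -[leRHS](powRr0 ((1 - b) / p)); apply: ler_powR; last exact: ltW.
    by rewrite ler_pdivlMr// mul1r.
  have h2 : (1 - p) `^ (1 - k) * b `^ k <= 1 + g.
    rewrite bk -[leRHS]mul1r ler_wpM2r//; first by lra.
    rewrite -[leRHS](powRr0 (1 - p)); apply: ger_powR; last by lra.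
    by apply/andP; split; lra.
  rewrite [tau * _]mulrC.
  have : g = k * (k - 1) * tau / 2 by [].
  lra.
- have kk : k * (k - 1) < 0 by rewrite pmulr_rlt0// subr_lt0.
  (* Here k (k - 1) < 0, so the numerator must be at least - g. The first power is dropped, and p <=
     a makes the second at least 1 - a >= 1 - g. The cap 1/2 keeps a < 1. *)
  pose g := - (k * (k - 1)) * tau.
  have g0 : 0 < g by rewrite mulr_gt0// oppr_gt0.
  pose a := Num.min 2^-1 g.
  have a0 : 0 < a by rewrite lt_min g0 invr_gt0 ltr0n.
  have a1 : a <= 2^-1 by rewrite ge_min lexx.
  have ag : a <= g by rewrite ge_min lexx orbT.
  exists a, a; split=> //; first by apply/andP; split; lra.
  move=> p p0 pa; split=> //.
  rewrite ler_ndivrMr// [tau * _]mulrC.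
  have h1 : 0 <= p `^ (1 - k) * a `^ k by rewrite mulr_ge0 ?powR_ge0.
  have h2 : 1 - a <= (1 - p) `^ (1 - k) * (1 - a) `^ k.
    have a1' : 0 < 1 - a by lra.
    rewrite [leLHS](_ : _ = (1 - a) `^ (1 - k) * (1 - a) `^ k); last first.
      by rewrite -powRD ?subrK ?powRr1 ?ltW// (gt_eqF a1') implybT.
    rewrite ler_wpM2r ?powR_ge0//; apply: ge0_ler_powR; rewrite ?nnegrE; lra.
  have : g = - (k * (k - 1)) * tau by [].
  lra.
Qed.

Lemma phi_power_le1E x : 0 < x ->
  phi_power k x = ((x `^ k - k * x + k - 1) / (k * (k - 1)))%:E.
Proof. by move=> x0; rewrite /phi_power ltNge ltW// gt_eqF. Qed.

(** Young's inequality again. For k < 0 it is applied to x^(k/(1-k)) and its inverse, with product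
    1; for k > 0 to x^k and 1. *)
Lemma phi_power_le1_ge0 x : 0 < x -> (0 <= phi_power k x)%E.
Proof.
move=> x0; rewrite phi_power_le1E// lee_fin; have k1 := k_lt1.
have [k0|k0|k0] := ltgtP k 0; last by move: k_neq0; rewrite k0 eqxx.
- have k10 : 0 < 1 - k by lra.
  rewrite divr_ge0 ?nmulr_rge0 ?subr_le0 ?(ltW k_lt1)//.
  have t0 : 0 < (1 - k) / - k by rewrite divr_gt0// oppr_gt0.
  have := @conjugate_powR R (x `^ (k / (1 - k))) (x `^ (- k / (1 - k)))
    (1 - k) ((1 - k) / - k) (powR_ge0 _ _) (powR_ge0 _ _) k10 t0.
  rewrite -powRD; last by rewrite (gt_eqF x0) implybT.
  rewrite (_ : k / (1 - k) + - k / (1 - k) = 0); last by ring.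
  rewrite powRr0 -!powRrM.
  rewrite (_ : k / (1 - k) * (1 - k) = k); last by rewrite divfK// gt_eqF.
  rewrite (_ : - k / (1 - k) * ((1 - k) / - k) = 1); last first.
    by field; rewrite (lt_eqF k0) gt_eqF.
  rewrite powRr1 ?(ltW x0)// (_ : (1 - k)^-1 + _ = 1); last first.
    by field; rewrite (lt_eqF k0) gt_eqF.
  move=> /(_ erefl); rewrite -(ler_pM2l k10).
  rewrite (_ : (1 - k) * (_ + _) = x `^ k - k * x); first by lra.
  by field; rewrite (lt_eqF k0) gt_eqF.
- have k10 : 0 < 1 - k by lra.
  rewrite ler_ndivlMr ?pmulr_rlt0 ?subr_lt0// mul0r.
  have := @conjugate_powR R (x `^ k) 1 k^-1 (1 - k)^-1 (powR_ge0 _ _) ler01.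
  rewrite !invr_gt0 !invrK => /(_ k0 k10); rewrite addrC subrK => /(_ erefl).
  rewrite mulr1 -powRrM mulfV ?gt_eqF// powRr1 ?(ltW x0)// powR1; lra.
Qed.

Definition indic_true (b : bool) : R := b%:R.

Lemma risk_dirac_false :
  risk (phi_power k) tau (\d_false : probability bool R) indic_true = 0%E.
Proof.
apply/eqP; rewrite eq_le; apply/andP; split.
  apply: ge_ereal_sup => _ [zeta _ <-].
  by rewrite integral_dirac// diracT mul1e mul0r.
apply: ereal_sup_ubound; exists (fun=> 1); last first.
  by rewrite integral_dirac// diracT mul1e mul0r.
split => //.
- by rewrite integral_dirac// diracT mul1e.
- rewrite integral_dirac// diracT mul1e phi_power_le1E// lee_fin powR1.
  rewrite (_ : _ / _ = 0); first exact: ltW.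
  by apply/eqP; rewrite mulf_eq0; apply/orP; left; apply/eqP; ring.
Qed.

Let integral_bernoulliE (p : R) (f : bool -> \bar R) : 0 <= p <= 1 ->
  (forall b, 0 <= f b)%E ->
  (\int[bernoulli_prob p]_b f b = p%:E * f true + (1 - p)%:E * f false)%E.
Proof. by move=> p01 f0; rewrite integral_bernoulli_prob. Qed.

(** The density tilts the Bernoulli law of parameter [p] into that of parameter [a]; the hypothesis
    is its divergence. *)
Lemma risk_bernoulli_ge (a p : R) : 0 < p -> p < 1 -> 0 < a -> a < 1 ->
  (p `^ (1 - k) * a `^ k + (1 - p) `^ (1 - k) * (1 - a) `^ k - 1)
    / (k * (k - 1)) <= tau ->
  (a%:E <= risk (phi_power k) tau
    (bernoulli_prob p : probability bool R) indic_true)%E.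
Proof.
move=> p0 p1 a0 a1 cost.
have q0 : 0 < 1 - p by rewrite subr_gt0.
have b0 : 0 < 1 - a by rewrite subr_gt0.
have p01 : 0 <= p <= 1 by rewrite !ltW.
pose zeta (b : bool) : R := if b then a / p else (1 - a) / (1 - p).
have z0 b : 0 < zeta b by case: b; rewrite divr_gt0.
apply: ereal_sup_ubound; exists zeta; last first.
  rewrite integral_bernoulliE//; last first.
    by move=> b; rewrite lee_fin mulr_ge0// ltW.
  rewrite /indic_true/= mul0r mule0 adde0 mul1r -EFinM; congr EFin.
  by rewrite mulrC divfK// gt_eqF.
split => //.
- by move=> b; exact: ltW.
- rewrite integral_bernoulliE//; last by move=> b; rewrite lee_fin ltW.
  rewrite /= -!EFinM -EFinD; congr EFin.
  by field; rewrite !gt_eqF.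
- rewrite integral_bernoulliE//; last first.
    by move=> b; exact: phi_power_le1_ge0.
  rewrite !phi_power_le1E// -!EFinM -EFinD lee_fin.
  apply: le_trans cost; rewrite le_eqVlt; apply/orP; left; apply/eqP.
  rewrite /zeta !powR_div ?(ltW a0) ?(ltW b0)// !powRB; last 2 first.
  - by rewrite (gt_eqF q0) implybT.
  - by rewrite (gt_eqF p0) implybT.
  rewrite !powRr1 ?(ltW p0) ?(ltW q0)//.
  have pk : 0 < p `^ k by exact: powR_gt0.
  have qk : 0 < (1 - p) `^ k by exact: powR_gt0.
  by field; rewrite k_neq0 subr_eq0 lt_eqF// !gt_eqF.
Qed.


Lemma bernoulli_ineq (p : R) n : 0 <= p <= 1 -> 1 - n%:R * p <= (1 - p) ^+ n.
Proof.
move=> /andP[p0 p1]; elim: n => [|n IHn]; first by rewrite mul0r subr0 expr0.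
have q0 : 0 <= 1 - p by rewrite subr_ge0.
rewrite exprS; apply: (@le_trans _ _ ((1 - p) * (1 - n%:R * p))).
  rewrite -natr1 -subr_ge0 (_ : _ - _ = n%:R * p ^+ 2); last by ring.
  by rewrite mulr_ge0 ?sqr_ge0.
by rewrite ler_wpM2l.
Qed.

(** Counts only the all-[false] sample, so the behaviour of an estimator at a single point
    suffices. *)
Lemma power_prob_nseq_false (P : probability bool R) n (r : R)
    (E : set (n.-tuple bool)) :
  P [set false] = r%:E -> E (nseq_tuple n false) ->
  ((r ^+ n)%:E <= power_prob P n E)%E.
Proof.
move=> Pr En.
have <- : power_prob P n [set w | forall i, [set false] (tnth w i)] = (r ^+ n)%:E.
  rewrite (@power_probE _ _ _ P n (fun=> [set false]))//; under eq_bigr do rewrite Pr.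
  elim: n {E En} => [|n IHn]; first by rewrite big_ord0.
  by rewrite big_ord_recl IHn -EFinM exprS.
apply: le_power_prob => w wf; rewrite (_ : w = nseq_tuple n false)//.
by apply: eq_from_tnth => i; rewrite wf tnth_nseq.
Qed.

(** Two-point argument: as eps < a / 2, the value of [Rhat] at the all-[false] sample cannot be
    within [eps] both of 0, the risk under the Dirac mass, and of a Bernoulli risk of at least
    [a]. *)
Theorem no_uniform_estimator : exists (d : measure_display)
    (T : measurableType d) (X : T -> R),
  [/\ measurable_fun [set: T] X,
      exists M : R, forall x, `|X x| <= M &
  exists eps0 : R, 0 < eps0 /\
  forall eps : R, 0 < eps < eps0 ->
  forall n : nat, (0 < n)%N ->
  forall Rhat : n.-tuple T -> R, measurable_fun [set: n.-tuple T] Rhat ->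
  exists P : probability T R,
  ((4^-1)%:E <=
    power_prob P n
      [set w | eps%:E < `|(Rhat w)%:E - risk (phi_power k) tau P X|])%E].
Proof.
have [a [p0 [/andP[a0 a1] p00 cost]]] := cheap_mass_transfer.
exists default_measure_display, bool, indic_true; split => //.
  by exists 1 => -[]; rewrite /indic_true/= ?normr1 ?normr0.
exists (a / 2); split; first exact: divr_gt0.
move=> eps /andP[e0 ea] n n0 Rhat _.
set w0 := nseq_tuple n false.
have [far|near] := ltP eps `|Rhat w0|.
  exists \d_false.
  apply: (@le_trans _ _ (1 ^+ n)%:E).
    by rewrite expr1n lee_fin invf_le1// ler1n.
  have d1 : (\d_false : probability bool R) [set false] = 1%:E.
    by rewrite /= diracE mem_set.
  apply: (power_prob_nseq_false d1).
  by rewrite /= risk_dirac_false sube0 /= lte_fin.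
have nR : 0 < n%:R :> R by rewrite ltr0n.
(* Taking p <= 1 / (2 n) makes the all-[false] sample have probability (1 - p)^n >= 1 - n p >=
   1/2. *)
pose p := Num.min p0 (2 * n%:R)^-1.
have pn : 0 < (2 * n%:R)^-1 :> R by rewrite invr_gt0 mulr_gt0.
have p_gt0 : 0 < p by rewrite lt_min p00.
have pp0 : p <= p0 by rewrite ge_min lexx.
have np : n%:R * p <= 2^-1.
  apply: (@le_trans _ _ (n%:R * (2 * n%:R)^-1)).
    by rewrite ler_wpM2l// ge_min lexx orbT.
  by rewrite invfM mulrCA mulfV ?gt_eqF// mulr1.
have [pa costp] := cost p p_gt0 pp0.
have p1 : p < 1 by exact: le_lt_trans a1.
have p01 : 0 <= p <= 1 by rewrite !ltW.
exists (bernoulli_prob p).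
apply: (@le_trans _ _ ((1 - p) ^+ n)%:E).
  rewrite lee_fin; apply: le_trans (bernoulli_ineq n p01).
  lra.
apply: power_prob_nseq_false.
  rewrite /= bernoulli_probE// !diracE memNset//= mem_set//.
  by rewrite mule0 add0e mule1.
rewrite /= -/w0.
have := risk_bernoulli_ge p_gt0 p1 a0 a1 costp.
case: (risk _ _ _ _) => [r| |]//=; last by rewrite ltry.
rewrite lee_fin lte_fin => ar; move: near; rewrite ler_norml => /andP[_ near].
by rewrite distrC; apply: lt_le_trans (ler_norm _); lra.
Qed.

End lower_bound.

Theorem corollary4p9 (R : realType) (k tau : R)
    (k_neq0 : k != 0) (k_neq1 : k != 1) (tau_gt0 : 0 < tau) :
  (1 < k ->
    exists C : R, 0 < C /\
    forall (B : R), 0 < B ->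
    forall (d : measure_display) (T : measurableType d)
      (P : probability T R) (X : T -> R),
    measurable_fun [set: T] X -> (forall x, X x \in `[- B, B]) ->
    forall delta : R, 0 < delta < 1 ->
    forall eps : R, 0 < eps <= B ->
    forall n : nat,
    let Lambda := ln (expR 1 + B + B^-1 + eps^-1 + delta^-1) in
    C * Lambda `^ C * (B / eps) `^ Num.max 2 (k / (k - 1)) <= n%:R ->
    ((1 - delta)%:E <=
      power_prob P n
        [set w | `|risk (phi_power k) tau P X
                   - risk (phi_power k) tau (empirical R w) X| <= eps%:E])%E)
  /\
  (k < 1 ->
    exists (d : measure_display) (T : measurableType d) (X : T -> R),
    [/\ measurable_fun [set: T] X,
        exists M : R, forall x, `|X x| <= M &
    exists eps0 : R, 0 < eps0 /\
    forall eps : R, 0 < eps < eps0 ->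
    forall n : nat, (0 < n)%N ->
    forall Rhat : n.-tuple T -> R, measurable_fun [set: n.-tuple T] Rhat ->
    exists P : probability T R,
    ((4^-1)%:E <=
      power_prob P n
        [set w | eps%:E < `|(Rhat w)%:E - risk (phi_power k) tau P X|])%E]).
Proof.
split=> [k1|k1]; first exact: risk_sample_complexity.
exact: no_uniform_estimator.
Qed.
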